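(* Let $d \geq 1$ and $\widetilde Z \sim \widetilde Z(2n, n^{-\alpha})$. If $\alpha < 1/d$, then with overwhelming probability $H_{2d}(\widetilde Z; \mathbb{Q}) = 0$. If $\alpha < 1/(d+1)$, then with overwhelming probability $H_{2d-1}(\widetilde Z; \mathbb{Q}) = 0$.
   Context: For a finite simple graph $G$, $\widetilde Z(G)$ is the simplicial complex on $V(G)\times\{-1,+1\}$ whose faces are $(\sigma\times\{-1\})\cup(\tau\times\{+1\})$ for (possibly empty) cliques $\sigma,\tau$ of $G$ that are disjoint with no edge of $G$ between them (the separated deleted join of the clique complex of $G$). $\widetilde Z(2n,p)$ is the distribution of $\widetilde Z(G)$ for $G\sim G(n,p)$, the Erdős–Rényi random graph on $[n]$. Here $\alpha>0$. ''With overwhelming probability'' means with probability at least $1-n^{-\omega(1)}$ as $n\to\infty$. *)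

(* Defs.v *)
From HB Require Import structures.
From mathcomp Require Import all_boot all_order all_algebra.
From mathcomp Require Import boolp reals exp.
Set Implicit Arguments. Unset Strict Implicit. Unset Printing Implicit Defensive.
Import Order.TTheory GRing.Theory Num.Theory.
Local Open Scope ring_scope.

Section Homology.
Variable V : finType.

Definition is_simplicial_complex (K : {set {set V}}) : bool :=
  [forall s in K, forall t : {set V}, (t \subset s) ==> (t \in K)].

(* Vertices are oriented by the fixed total order enum_rank on V.  The
   incidence coefficient [sigma : tau] of the boundary map from
   k-chains (faces with k+1 vertices) to (k-1)-chains; the boundary of a
   0-chain is 0 (unreduced homology). *)
Definition incid (K : {set {set V}}) (k : nat) (s t : {set V}) : rat :=
  if [&& s \in K, #|s| == k.+1 & (0 < k)%N] then
    \sum_(v in s) (if t == s :\ v then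
                     (-1) ^+ #|[set u in s | (enum_rank u < enum_rank v)%N]|
                   else 0)
  else 0.

Definition boundary (K : {set {set V}}) (k : nat) (c : {ffun {set V} -> rat})
  : {ffun {set V} -> rat} :=
  [ffun t => \sum_(s : {set V}) c s * incid K k s t].

Definition is_kchain (K : {set {set V}}) (k : nat) (c : {ffun {set V} -> rat}) :=
  forall s, c s != 0 -> (s \in K) && (#|s| == k.+1).

Definition homology_vanishes (K : {set {set V}}) (k : nat) : Prop :=
  forall c, is_kchain K k c -> boundary K k c = 0 ->
    exists e, is_kchain K k.+1 e /\ boundary K k.+1 e = c.
End Homology.

Definition all_pairs (n : nat) : {set {set 'I_n}} := [set e : {set 'I_n} | #|e| == 2].
Definition is_graph n (E : {set {set 'I_n}}) : bool := E \subset all_pairs n.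

Definition adj n (E : {set {set 'I_n}}) (i j : 'I_n) : bool :=
  (i != j) && ([set i; j] \in E).

Definition is_clique n (E : {set {set 'I_n}}) (s : {set 'I_n}) : bool :=
  [forall i in s, forall j in s, (i != j) ==> adj E i j].

(* vertex (i, false) stands for (i,-1) and (i, true) for (i,+1) *)
Definition Zt n (E : {set {set 'I_n}}) : {set {set ('I_n * bool)}} :=
  [set F : {set ('I_n * bool)} |
    let s := [set i | (i, false) \in F] in
    let t := [set i | (i, true) \in F] in
    [&& is_clique E s, is_clique E t, [disjoint s & t] &
        [forall i in s, forall j in t, ~~ adj E i j]]].

Definition ER_weight (R : realType) n (p : R) (E : {set {set 'I_n}}) : R :=
  p ^+ #|E| * (1 - p) ^+ ('C(n, 2) - #|E|).

Definition ER_prob (R : realType) n (p : R) (P : {set {set 'I_n}} -> Prop) : R :=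
  \sum_(E : {set {set 'I_n}} | is_graph E && `[< P E >]) ER_weight p E.

(* "with overwhelming probability" for G ~ G(n, n^-alpha):
   failure probability is n^{-omega(1)}, i.e. <= n^{-C} eventually, for all C *)
Definition whp_overwhelming (R : realType) (alpha : R)
  (P : forall n, {set {set 'I_n}} -> Prop) : Prop :=
  forall C : R, 0 < C -> exists N : nat, forall n : nat, (N <= n)%N ->
    ER_prob (n%:R `^ (- alpha)) (fun E => ~ P n E) <= n%:R `^ (- C).

(* Main.v *)
Require Import Defs.
From HB Require Import structures.
From mathcomp Require Import all_boot all_order all_algebra.
From mathcomp Require Import boolp reals exp.
From mathcomp Require Import zify ring lra.
Import Order.TTheory GRing.Theory Num.Theory.
Local Open Scope ring_scope.
Set Implicit Arguments. Unset Strict Implicit. Unset Printing Implicit Defensive.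

(** Garland's method.  By a local-to-global identity, [H_k] of a complex vanishes
    as soon as, in the link graph of every [(k-1)]-face, the adjacency form is
    at most [1/(k+2)] times the degree form on functions orthogonal to constants.

    The complex is flag, and the link graph of a face [(sigma, tau)] with
    [|sigma| <= |tau|] consists of the common neighbours [B] of [sigma] missing
    [tau] and the common neighbours [A] of [tau] missing [sigma], joined by [G]
    inside [A] and inside [B] and by the complement of [G] across.  Up to small
    errors its adjacency form is [p (sum_B f)^2 + 2 (sum_B f) (sum_A f)], and
    orthogonality to constants makes this nonpositive.  The errors are controlled
    by two properties of [G]: sets of at most [d] vertices have about
    [n p^|sigma|] common neighbours and larger sets have far fewer, and for
    [|sigma| < d] the centred adjacency matrix of [G] on the common neighbours of
    [sigma] has small spectral norm.

    Both hold with overwhelming probability because [n p^d] is a positive power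
    of [n]: a fixed high moment (of a centred degree, resp. the trace of a high
    power of the centred matrix) only receives contributions from products in
    which every edge is repeated, and Markov's inequality at a sufficiently high
    moment beats every power of [n]. *)

(** * Garland's criterion *)

(** Weighted least squares: [y] projects [c] onto the row space of [P] for the inner product with
    weights [w]. The normal equations are solvable because any vector killed by the Gram matrix
    [PM *m W] is already killed by [W], the quadratic form being positive definite over an ordered
    field. *)
Lemma orthogonal_residue (F : realFieldType) (I J : finType) (P : I -> J -> F)
    (w c : J -> F) : (forall j, 0 < w j) ->
  exists y : I -> F, forall i,
    \sum_j (c j - \sum_i' y i' * P i' j) * w j * P i j = 0.
Proof.
move=> w0.
pose PM : 'M[F]_(#|I|, #|J|) := \matrix_(i, j) P (enum_val i) (enum_val j).
pose W : 'M[F]_(#|J|, #|I|) := \matrix_(j, i) (w (enum_val j) * P (enum_val i) (enum_val j)).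
pose cM : 'rV[F]_#|J| := \row_j c (enum_val j).
have sub : (cM *m W <= PM *m W)%MS.
  rewrite submxE -mulmxA.
  suff -> : W *m cokermx (PM *m W) = 0 by rewrite mulmx0.
  apply/matrixP => j i; rewrite [RHS]mxE.
  have := mulmx_coker (PM *m W); set X := cokermx _ => PX.
  have cX : PM *m W *m col i X = 0 by rewrite colE mulmxA PX mul0mx.
  pose z (j : 'I_#|J|) := \sum_l P (enum_val l) (enum_val j) * X l i.
  have zE l : (W *m col i X) l 0 = w (enum_val l) * z l.
    rewrite mxE mulr_sumr; apply: eq_bigr => h _; rewrite !mxE; ring.
  (* Pairing the kernel vector with its image under the Gram matrix gives a weighted sum of
     squares. *)
  have q0 : \sum_l w (enum_val l) * z l ^+ 2 = 0.
    have : ((col i X)^T *m (PM *m W *m col i X)) 0 0 = 0 by rewrite cX mulmx0 mxE.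
    rewrite -(mulmxA PM) (mulmxA _^T PM) mxE => E; rewrite -[RHS]E; apply: eq_bigr => l _.
    rewrite zE mxE [X in _ = X * _](_ : _ = z l); first by ring.
    by apply: eq_bigr => h _; rewrite !mxE mulrC.
  have zj : z j = 0.
    move/eqP: q0; rewrite psumr_eq0; last first.
      by move=> l _; rewrite mulr_ge0 ?sqr_ge0 ?ltW.
    move/allP/(_ j (mem_index_enum _)); rewrite /= mulf_eq0 expf_eq0 /=.
    by rewrite (gt_eqF (w0 _)) /= => /eqP.
  have := zE j; rewrite zj mulr0 => <-; rewrite !mxE.
  by apply: eq_bigr => h _; rewrite !mxE.
have [y yE] := submxP sub.
exists (fun i => y 0 (enum_rank i)) => i.
have := congr1 (fun M : 'rV_#|I| => M 0 (enum_rank i)) yE.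
rewrite mulmxA => /eqP; rewrite -subr_eq0 => /eqP.
rewrite !mxE -sumrB => E; rewrite -[RHS]E.
rewrite (reindex (@enum_val J predT)) /=; last exact/onW_bij/enum_val_bij.
apply: eq_bigr => j _; rewrite !mxE enum_rankK -mulrA -mulrBl; congr ((_ - _) * _).
rewrite (reindex (@enum_val I predT)) /=; last exact/onW_bij/enum_val_bij.
by apply: eq_bigr => h _; rewrite !mxE enum_valK.
Qed.

(** * Signs, boundaries and the local-to-global identity *)

Section Garland.
Variable V : finType.
Implicit Types (K : {set {set V}}) (s t : {set V}) (u v : V).

Definition vlink K t : {set V} := [set u | (u \notin t) && (u |: t \in K)].

(** The sign of the facet [s :\ v] in the boundary of [s]. The strict inequality ignores [v] itself,
    so the value does not depend on whether [v] already belongs to [s]. *)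
Definition orient v s : rat :=
  (-1) ^+ #|[set u in s | (enum_rank u < enum_rank v)%N]|.

Lemma orient_sqr v s : orient v s * orient v s = 1.
Proof. by rewrite -expr2 sqrr_sign. Qed.

Lemma orient_set1U v s : orient v (v |: s) = orient v s.
Proof.
rewrite /orient; congr (_ ^+ #|pred_of_set _|); apply/setP => u; rewrite !inE.
by case: eqP => //= ->; rewrite ltnn andbF.
Qed.

Lemma orient_setD1 u v s : u \in s -> u != v ->
  orient v s = (if (enum_rank u < enum_rank v)%N then -1 else 1) * orient v (s :\ u).
Proof.
move=> us uv; rewrite /orient.
rewrite (cardsD1 u [set u0 in s | _]) inE us /=.
have -> : [set u0 in s | (enum_rank u0 < enum_rank v)%N] :\ u =
  [set u0 in s :\ u | (enum_rank u0 < enum_rank v)%N].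
  by apply/setP => x; rewrite !inE andbA.
by case: ifP => _; rewrite exprD ?expr1 ?expr0 ?mul1r.
Qed.

(** Deleting the smaller of [u] and [v] flips the sign attached to the larger one, while deleting
    the larger leaves the other sign alone. This yields both the vanishing of the double boundary
    and the minus sign in Garland's identity. *)
Lemma orient_swap u v s : u \in s -> v \in s -> u != v ->
  orient u s * orient v (s :\ u) = - (orient v s * orient u (s :\ v)).
Proof.
move=> us vs uv.
rewrite (orient_setD1 us uv) (@orient_setD1 v u s vs); last by rewrite eq_sym.
have ne : (enum_rank u : nat) != enum_rank v.
  by rewrite (inj_eq val_inj) (inj_eq enum_rank_inj).
by case: (ltngtP (enum_rank u) (enum_rank v)) ne => // _ _; ring.
Qed.

Lemma complex_subset_closed K s t : is_simplicial_complex K -> s \in K -> t \subset s -> t \in K.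
Proof. by move=> /forall_inP H sK ts; have /forallP/(_ t)/implyP := H s sK; apply. Qed.

(** Double counting of pairs of a face and a vertex in it, indexed either by the large face or by
    what remains once the vertex is removed. *)
Lemma sum_faces_vlink (F : nmodType) K j (G : {set V} -> V -> F) :
  is_simplicial_complex K ->
  \sum_(s | (s \in K) && (#|s| == j.+1)) \sum_(u in s) G (s :\ u) u =
  \sum_(t | (t \in K) && (#|t| == j)) \sum_(u in vlink K t) G t u.
Proof.
move=> hK; rewrite (exchange_big_dep predT) //= [RHS](exchange_big_dep predT) //=.
apply: eq_bigr => u _.
rewrite (reindex_onto (fun t => u |: t) (fun s => s :\ u)) /=; last first.
  by move=> s /andP[_ us]; rewrite setD1K.
apply: eq_big => t.
  rewrite !inE eqxx /= andbT; apply/idP/idP.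
    case/andP => /andP[utK] /eqP c /eqP e.
    have ut : u \notin t by rewrite -e !inE eqxx.
    move: c; rewrite cardsU1 ut add1n => -[->].
    by rewrite utK eqxx /= !andbT (complex_subset_closed hK utK) // subsetUr.
  case/andP => /andP[tK /eqP c] /andP[ut utK].
  by rewrite utK cardsU1 ut c add1n eqxx setU1K // eqxx.
by case/andP => _ /eqP ->.
Qed.

Lemma boundaryE K j (c : {ffun {set V} -> rat}) t :
  (0 < j)%N -> is_kchain K j c ->
  boundary K j c t = \sum_(u | u \notin t) c (u |: t) * orient u (u |: t).
Proof.
move=> j0 hc; rewrite ffunE.
transitivity (\sum_(s : {set V}) \sum_(u in s) if t == s :\ u then c s * orient u s else 0).
  apply: eq_bigr => s _; rewrite /incid.
  have [cs|cs] := eqVneq (c s) 0.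
    by rewrite cs mul0r big1 // => u _; case: ifP; rewrite ?mul0r.
  have /andP[sK sj] := hc s cs; rewrite sK sj j0 /= mulr_sumr.
  by apply: eq_bigr => u _; case: ifP => // _; rewrite mulr0.
rewrite (exchange_big_dep predT) //= [RHS]big_mkcond; apply: eq_bigr => u _.
case: ifP => ut.
  rewrite (bigD1 (u |: t)) ?setU11 //= setU1K // eqxx big1 ?addr0 // => s /andP[us].
  by case: (t =P s :\ u) => // ->; rewrite setD1K // eqxx.
rewrite big1 // => s us; case: eqP => // e.
by move: ut; rewrite e !inE eqxx.
Qed.

Lemma incidE K j s t : (0 < j)%N -> s \in K -> #|s| = j.+1 ->
  incid K j s t = \sum_(v in s) if t == s :\ v then orient v s else 0.
Proof. by move=> j0 sK sj; rewrite /incid sK sj eqxx j0. Qed.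

Lemma incid_sum K j s (g : {set V} -> rat) : (0 < j)%N -> s \in K -> #|s| = j.+1 ->
  \sum_t g t * incid K j s t = \sum_(v in s) g (s :\ v) * orient v s.
Proof.
move=> j0 sK sj; under eq_bigr => t _ do rewrite incidE // mulr_sumr.
rewrite exchange_big; apply: eq_bigr => v vs.
rewrite (bigD1 (s :\ v)) //= eqxx big1 ?addr0 // => t /negPf ->.
by rewrite mulr0.
Qed.

Lemma boundary_kchain K j c : is_simplicial_complex K -> (0 < j)%N ->
  is_kchain K j (boundary K j.+1 c).
Proof.
move=> hK j0 t; rewrite ffunE => ne.
have [s] : exists s, (c s * incid K j.+1 s t != 0).
  apply/existsP; apply: contraNT ne; rewrite negb_exists => /forallP H.
  by rewrite big1 // => s _; apply/eqP; have := H s; rewrite negbK.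
rewrite /incid; case: ifP; rewrite ?mulr0 ?eqxx // => /and3P[sK /eqP sj _].
rewrite mulf_eq0 negb_or => /andP[_].
case: (boolP [exists v in s, t == s :\ v]) => [/exists_inP[v vs /eqP ->] _|].
  rewrite (complex_subset_closed hK sK) ?subD1set //=.
  by move: (cardsD1 v s); rewrite vs sj add1n => -[->].
rewrite negb_exists_in => /forall_inP H; rewrite big1 ?eqxx // => v /H /negPf ->.
by [].
Qed.

(** The double sum over the two added vertices is antisymmetric by [orient_swap], hence equal to its
    own negative. *)
Lemma boundary_boundary K j e : is_simplicial_complex K -> (0 < j)%N ->
  is_kchain K j.+1 e -> boundary K j (boundary K j.+1 e) = 0.
Proof.
move=> hK j0 he; apply/ffunP => t; rewrite boundaryE //; last exact: boundary_kchain.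
rewrite [RHS]ffunE.
pose a u v := e (v |: (u |: t)) * orient v (v |: (u |: t)) * orient u (u |: t).
have aE u v : u != v -> u \notin t -> v \notin t -> a v u = - a u v.
  move=> uv ut vt; rewrite /a setUCA -!mulrA -mulrN; congr (_ * _).
  set s := v |: (u |: t).
  have D1 : s :\ v = u |: t by rewrite setU1K // !inE negb_or vt eq_sym uv.
  have D2 : s :\ u = v |: t by rewrite /s setUCA setU1K // !inE negb_or ut uv.
  by rewrite -D1 -D2 orient_swap // !inE eqxx ?orbT.
pose S := \sum_(u | u \notin t) \sum_(v | (v \notin t) && (v != u)) a u v.
have -> : \sum_(u | u \notin t) boundary K j.+1 e (u |: t) * orient u (u |: t) = S.
  apply: eq_bigr => u ut; rewrite boundaryE // mulr_suml.
  by apply: eq_bigl => v; rewrite !inE negb_or andbC.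
have : S = - S.
  rewrite {1}/S (exchange_big_dep (fun v => v \notin t)) /=; last by move=> u v _ /andP[].
  rewrite -sumrN; apply: eq_bigr => v vt; rewrite -sumrN.
  apply: eq_big => [u|u /andP[ut]]; first by rewrite vt /= eq_sym.
  by rewrite vt /= => uv; rewrite aE // eq_sym.
by move/eqP; rewrite -addr_eq0 -mulr2n mulrn_eq0 /= => /eqP.
Qed.

(** Square the cocycle relation on each face with [k.+2] vertices and sum over these faces. The
    diagonal terms give the left side. The off-diagonal terms, regrouped by the face left after
    removing both vertices, give minus the adjacency forms of the link graphs; there
    [vlink K (u |: t)] is the neighbourhood of [u] in the link graph of [t]. *)
Lemma garland_identity K k (phi : {set V} -> rat) : is_simplicial_complex K ->
  (forall s, s \in K -> #|s| = k.+2 -> \sum_(v in s) phi (s :\ v) * orient v s = 0) ->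
  \sum_(s | (s \in K) && (#|s| == k.+1)) #|vlink K s|%:R * phi s ^+ 2 =
  \sum_(t | (t \in K) && (#|t| == k)) \sum_(u in vlink K t) \sum_(v in vlink K (u |: t))
     (orient u t * phi (u |: t)) * (orient v t * phi (v |: t)).
Proof.
move=> hK hphi.
pose f t u := orient u t * phi (u |: t).
have diag : \sum_(s | (s \in K) && (#|s| == k.+1)) #|vlink K s|%:R * phi s ^+ 2 =
  \sum_(s | (s \in K) && (#|s| == k.+2)) \sum_(u in s) (phi (s :\ u) * orient u s) ^+ 2.
  under [RHS]eq_bigr => s _ do under eq_bigr => u _ do
    rewrite exprMn (expr2 (orient _ _)) orient_sqr mulr1.
  rewrite (sum_faces_vlink k.+1 (fun t _ => phi t ^+ 2) hK); apply: eq_bigr => s _.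
  by rewrite sumr_const mulr_natl.
have offd : \sum_(t | (t \in K) && (#|t| == k)) \sum_(u in vlink K t)
     \sum_(v in vlink K (u |: t)) f t u * f t v =
  - \sum_(s | (s \in K) && (#|s| == k.+2)) \sum_(u in s) \sum_(v in s :\ u)
     (phi (s :\ u) * orient u s) * (phi (s :\ v) * orient v s).
  transitivity (\sum_(t | (t \in K) && (#|t| == k)) \sum_(u in vlink K t)
     \sum_(v in vlink K (u |: t)) f ((u |: t) :\ u) u * f ((u |: t) :\ u) v).
    apply: eq_bigr => t _; apply: eq_bigr => u; rewrite inE => /andP[ut _].
    by rewrite setU1K.
  pose G t u := \sum_(v in vlink K (u |: t)) f ((u |: t) :\ u) u * f ((u |: t) :\ u) v.
  rewrite -(sum_faces_vlink k G hK) /G.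
  transitivity (\sum_(s | (s \in K) && (#|s| == k.+1)) \sum_(v in vlink K s)
     \sum_(u in s) f (s :\ u) u * f (s :\ u) v).
    apply: eq_bigr => s _; rewrite exchange_big; apply: eq_bigr => u us.
    by rewrite setD1K.
  rewrite -(sum_faces_vlink k.+1 (fun s v => \sum_(u in s) f (s :\ u) u * f (s :\ u) v) hK).
  rewrite -sumrN; apply: eq_bigr => s _; rewrite -sumrN; apply: eq_bigr => v vs.
  rewrite -sumrN; apply: eq_bigr => u; rewrite !inE => /andP[uv us].
  have vD : v \in s :\ u by rewrite !inE eq_sym uv.
  have uD : u \in s :\ v by rewrite !inE uv.
  have e1 : u |: s :\ v :\ u = s :\ v by rewrite setD1K.
  have e2 : v |: s :\ v :\ u = s :\ u by rewrite setDDl [[set v] :|: [set u]]setUC -setDDl setD1K.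
  rewrite /f e1 e2 -(orient_set1U u (s :\ v :\ u)) e1 -(orient_set1U v (s :\ v :\ u)) e2.
  have := orient_swap us vs uv; move: (orient_sqr u s) (orient_sqr v s).
  set a := orient u s; set b := orient v s; set x := orient u _; set y := orient v _.
  move=> aa bb E.
  have -> : x = - (a * y * b) by transitivity (b * b * x); [rewrite bb mul1r|rewrite -mulrA -[b * x]opprK -E; ring].
  have yy : y * y = 1 by exact: orient_sqr.
  transitivity (- (a * b * phi (s :\ v) * phi (s :\ u) * (y * y))); first by ring.
  by rewrite yy; ring.
rewrite offd diag; apply/eqP; rewrite -addr_eq0 -big_split /=; apply/eqP.
rewrite big1 // => s /andP[sK /eqP sk].
rewrite -big_split /=.
have := hphi s sK sk => /(congr1 (fun x => x ^+ 2)).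
rewrite expr0n /= expr2 mulr_suml => E; rewrite -[RHS]E; apply: eq_bigr => u us.
rewrite mulr_sumr [RHS](bigD1 u) //= expr2; congr (_ + _).
by apply: eq_bigl => v; rewrite !inE andbC.
Qed.

(** A cycle is replaced by the homologous cycle [c'] orthogonal to all boundaries, so that [phi],
    its quotient by the weight, is a cocycle. If [W] is the weighted square norm of [phi], summing
    the local bounds gives [W] at most [(k+1)/(k+2)] times [W], each face being counted once per
    vertex. Hence [W] and [c'] vanish. *)
Theorem garland K k : is_simplicial_complex K -> (0 < k)%N ->
  (forall t u, t \in K -> #|t| = k -> u \in vlink K t -> (0 < #|vlink K (u |: t)|)%N) ->
  (forall t (f : V -> rat), t \in K -> #|t| = k ->
     \sum_(u in vlink K t) #|vlink K (u |: t)|%:R * f u = 0 ->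
     \sum_(u in vlink K t) \sum_(v in vlink K (u |: t)) f u * f v <=
       k.+2%:R^-1 * \sum_(u in vlink K t) #|vlink K (u |: t)|%:R * f u ^+ 2) ->
  homology_vanishes K k.
Proof.
move=> hK k0 hdeg hloc c hc dc.
(* The default 1 makes [w] positive everywhere, as [orthogonal_residue] requires. *)
pose w s : rat := if (s \in K) && (#|s| == k.+1) then #|vlink K s|%:R else 1.
have w0 s : 0 < w s.
  rewrite /w; case: ifP => // /andP[sK /eqP sk]; rewrite ltr0n.
  have [u us] : exists u, u \in s by apply/set0Pn; rewrite -card_gt0 sk.
  have /hdeg : s :\ u \in K by rewrite (complex_subset_closed hK sK) // subD1set.
  move=> /(_ u); rewrite setD1K // inE setD1K // sK !inE eqxx; apply => //.
  by move: (cardsD1 u s); rewrite us sk add1n => -[].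
have [y yE] := @orthogonal_residue rat _ _ (incid K k.+1) (fun s => (w s)^-1) c
  (fun s => etrans (invr_gt0 _) (w0 s)).
(* Truncating [y] to faces of the right size makes it a chain and keeps its boundary, since [incid]
   vanishes on all other sets. *)
pose e : {ffun {set V} -> rat} :=
  [ffun s => if (s \in K) && (#|s| == k.+2) then y s else 0].
have he : is_kchain K k.+1 e.
  by move=> s; rewrite ffunE; case: ifP => //; rewrite eqxx.
exists e; split=> //.
have beE t : boundary K k.+1 e t = \sum_s y s * incid K k.+1 s t.
  rewrite ffunE; apply: eq_bigr => s _; rewrite ffunE /incid.
  by case: (s \in K); case: (#|s| == _); rewrite /= ?mulr0 ?mul0r.
pose c' := c - boundary K k.+1 e.
have hc' : is_kchain K k c'.
  move=> s; rewrite !ffunE; case: (boolP ((s \in K) && (#|s| == k.+1))) => // ns.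
  rewrite -[X in _ - X](ffunE _ s : boundary K k.+1 e s = _).
  have -> : c s = 0 by apply/eqP; apply: contraNT ns => /hc.
  have -> : boundary K k.+1 e s = 0.
    by apply/eqP; apply: contraNT ns => /(boundary_kchain hK k0).
  by rewrite subr0 eqxx.
have dc' : boundary K k c' = 0.
  transitivity (boundary K k c - boundary K k (boundary K k.+1 e)); last first.
    by rewrite dc boundary_boundary // subr0.
  apply/ffunP => t; rewrite !ffunE -sumrB; apply: eq_bigr => s _.
  by rewrite /c' !ffunE mulrBl.
pose phi s := c' s / w s.
have cocycle s : s \in K -> #|s| = k.+2 -> \sum_(v in s) phi (s :\ v) * orient v s = 0.
  move=> sK sk; rewrite -(incid_sum phi (ltn0Sn k) sK sk) -[RHS](yE s).
  by apply: eq_bigr => t _; rewrite /phi !ffunE -beE ffunE.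
have wphi s : w s * phi s = c' s by rewrite /phi mulrC divfK // gt_eqF.
have loc t : t \in K -> #|t| = k ->
  \sum_(u in vlink K t) \sum_(v in vlink K (u |: t))
     (orient u t * phi (u |: t)) * (orient v t * phi (v |: t)) <=
  k.+2%:R^-1 * \sum_(u in vlink K t) #|vlink K (u |: t)|%:R * phi (u |: t) ^+ 2.
  move=> tK tk; pose f u := orient u t * phi (u |: t).
  have wt u : u \in vlink K t -> #|vlink K (u |: t)|%:R = w (u |: t).
    by rewrite inE => /andP[ut utK]; rewrite /w utK cardsU1 ut tk eqxx.
  have -> : \sum_(u in vlink K t) #|vlink K (u |: t)|%:R * phi (u |: t) ^+ 2 =
            \sum_(u in vlink K t) #|vlink K (u |: t)|%:R * f u ^+ 2.
    by apply: eq_bigr => u _; rewrite /f [(orient u t * _) ^+ 2]exprMn (expr2 (orient _ _)) orient_sqr mul1r.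
  (* Evaluated at [t], the cycle condition on [c'] says that [f] is orthogonal to constants for the
     degree weights of the link graph. *)
  apply: hloc => //; have := congr1 (fun g : {ffun _ -> _} => g t) dc'.
  rewrite boundaryE // [RHS]ffunE => E; rewrite -[RHS]E.
  rewrite [RHS](bigID (mem (vlink K t))) /= [X in _ + X]big1 ?addr0; last first.
    move=> u /andP[ut]; rewrite inE ut /= => nK.
    have -> : c' (u |: t) = 0; last by rewrite mul0r.
    by apply/eqP; apply: contraNT nK => /hc' /andP[].
  apply: eq_big => [u|u ul]; first by rewrite inE; case: (u \in t).
  by rewrite wt // mulrCA wphi orient_set1U mulrC.
have W0 : \sum_(s | (s \in K) && (#|s| == k.+1)) #|vlink K s|%:R * phi s ^+ 2 = 0.
  set W := LHS.
  have Wge : 0 <= W by apply: sumr_ge0 => s _; rewrite mulr_ge0 ?sqr_ge0 ?ler0n.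
  have : W <= k.+2%:R^-1 * (k.+1%:R * W).
    rewrite {1}/W (garland_identity hK cocycle).
    have -> : k.+1%:R * W = \sum_(t | (t \in K) && (#|t| == k)) \sum_(u in vlink K t)
        #|vlink K (u |: t)|%:R * phi (u |: t) ^+ 2.
      rewrite -(sum_faces_vlink k (fun t u => #|vlink K (u |: t)|%:R * phi (u |: t) ^+ 2) hK).
      rewrite /W mulr_sumr; apply: eq_bigr => s /andP[_ /eqP sk].
      rewrite (eq_bigr (fun=> #|vlink K s|%:R * phi s ^+ 2)); last by move=> u us; rewrite setD1K.
      by rewrite sumr_const sk mulr_natl.
    rewrite mulr_sumr; apply: ler_sum => t /andP[tK /eqP tk]; exact: loc.
  have -> : k.+2%:R = k.+1%:R + 1 :> rat by rewrite -natr1.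
  have : 0 < (k.+1%:R + 1 : rat) by rewrite ltr_wpDl.
  set x := k.+1%:R => x0; rewrite ler_pdivlMl // => h; lra.
apply/ffunP => s; apply/eqP; rewrite eq_sym -subr_eq0.
have -> : c s - boundary K k.+1 e s = c' s by rewrite !ffunE.
apply/negPn/negP => cs; have /andP[sK sk] := hc' s cs.
move/eqP: W0; rewrite psumr_eq0; last by move=> ? _; rewrite mulr_ge0 ?sqr_ge0 ?ler0n.
move/allP/(_ s (mem_index_enum _)); rewrite sK sk /=.
have wE : #|vlink K s|%:R = w s by rewrite /w sK sk.
by rewrite wE expr2 mulrA wphi /phi !mulf_eq0 (negPf cs) /= invr_eq0 gt_eqF.
Qed.
End Garland.

(** * The adjacency form of a link *)

Section LinkBound.
Variables (R : realFieldType) (T : finType).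
Implicit Types (A B : {set T}) (f g h : T -> R).

Lemma sqr_sum_le A f : (\sum_(u in A) f u) ^+ 2 <= #|A|%:R * \sum_(u in A) f u ^+ 2.
Proof.
have : 0 <= \sum_(u in A) \sum_(v in A) (f u - f v) ^+ 2.
  by apply: sumr_ge0 => u _; apply: sumr_ge0 => v _; apply: sqr_ge0.
have -> : \sum_(u in A) \sum_(v in A) (f u - f v) ^+ 2 =
    #|A|%:R * (\sum_(u in A) f u ^+ 2) + #|A|%:R * (\sum_(u in A) f u ^+ 2)
    - 2 * (\sum_(u in A) f u) ^+ 2.
  under eq_bigr => u _.
    under eq_bigr => v _ do rewrite sqrrB.
    rewrite big_split sumrB /= sumr_const sumrMnl -mulr_sumr; over.
  rewrite big_split sumrB /= sumr_const !sumrMnl -mulr_suml.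
  set F := \sum_(u in A) f u ^+ 2; set S := \sum_(u in A) f u.
  rewrite -(mulr_natl F) -(mulr_natl (S * S)); move: (#|A|%:R : R) => N; ring.
by move=> H; lra.
Qed.

Lemma deviation_sqr_le A f g c :
  (forall u, u \in A -> `|f u| <= c) ->
  (\sum_(u in A) f u * g u) ^+ 2 <= #|A|%:R * (c ^+ 2 * \sum_(u in A) g u ^+ 2).
Proof.
move=> fc; apply: le_trans (sqr_sum_le _ _) _; rewrite ler_wpM2l ?ler0n //.
rewrite mulr_sumr; apply: ler_sum => u uA; rewrite exprMn ler_wpM2r ?sqr_ge0 //.
by rewrite -[f u ^+ 2]real_normK ?num_real // lerXn2r ?nnegrE ?fc // (le_trans _ (fc u uA)).
Qed.

Variable e : rel T.
Hypothesis e_sym : symmetric e.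

Definition degin A u : R := #|[set v in A | e u v]|%:R.

Lemma deginE A u : degin A u = \sum_(v in A) (e u v)%:R.
Proof.
rewrite /degin -sum1_card natr_sum big_mkcond [RHS]big_mkcond /=.
by apply: eq_bigr => v _; rewrite inE; case: (v \in A); case: (e u v).
Qed.

Lemma degin_ge0 A u : 0 <= degin A u. Proof. exact: ler0n. Qed.

(** The inequality of arithmetic and geometric means on each edge, so a bipartite form is controlled
    by the degrees alone. *)
Lemma cross_le A B g h :
  `|\sum_(u in B) \sum_(v in A) (e u v)%:R * g u * h v| *+ 2 <=
  \sum_(u in B) degin A u * g u ^+ 2 + \sum_(v in A) degin B v * h v ^+ 2.
Proof.
have -> : \sum_(u in B) degin A u * g u ^+ 2 =
    \sum_(u in B) \sum_(v in A) (e u v)%:R * g u ^+ 2.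
  by apply: eq_bigr => u _; rewrite deginE mulr_suml.
have -> : \sum_(v in A) degin B v * h v ^+ 2 =
    \sum_(u in B) \sum_(v in A) (e u v)%:R * h v ^+ 2.
  rewrite exchange_big; apply: eq_bigr => v _; rewrite deginE mulr_suml.
  by apply: eq_bigr => u _; rewrite e_sym.
rewrite -big_split /= -mulr_natl.
apply: le_trans (ler_wpM2l _ (ler_norm_sum _ _ _)) _ => //.
rewrite mulr_sumr; apply: ler_sum => u _.
rewrite -big_split /=; apply: le_trans (ler_wpM2l _ (ler_norm_sum _ _ _)) _ => //.
rewrite mulr_sumr; apply: ler_sum => v _.
case: (e u v); last by rewrite !mul0r normr0 mulr0 addr0.
rewrite !mul1r normrM -(real_normK (num_real (g u))) -(real_normK (num_real (h v))).
by have := sqr_ge0 (`|g u| - `|h v|); rewrite sqrrB; lra.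
Qed.

Variables (A B : {set T}) (p eps : R) (g h : T -> R).
Let b : R := #|B|%:R.
Let a : R := #|A|%:R.
(** The expected degree in the link graph of a vertex of [B]: a proportion [p] of [B] and nearly all
    of [A]. A vertex of [A] is expected to see nearly all of [B] and little of [A], hence degree
    about [b]. The exact degrees are [degB] and [degA]. *)
Let D := p * b + a.
Let degB u := degin B u + (a - degin A u).
Let degA v := degin A v + (b - degin B v).
Hypotheses (p0 : 0 <= p) (eps0 : 0 < eps) (eps8 : eps <= 8^-1) (b0 : 0 < b) (D0 : 0 < D).
Hypothesis HBB : forall u, u \in B -> `|degin B u - p * b| <= eps * D.
Hypothesis HBA : forall u, u \in B -> degin A u <= eps * D.
Hypothesis HAA : forall v, v \in A -> degin A v <= eps * b.
Hypothesis HAB : forall v, v \in A -> degin B v <= eps * b.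

Lemma degB_dev u : u \in B -> `|D - degB u| <= 2 * eps * D.
Proof.
move=> uB; have := HBB uB; have := HBA uB; have := degin_ge0 A u.
rewrite !ler_norml /degB /D => ? ? /andP[? ?]; apply/andP; split; lra.
Qed.

Lemma degA_dev v : v \in A -> `|b - degA v| <= eps * b.
Proof.
move=> vA; have := HAA vA; have := HAB vA; have := degin_ge0 A v; have := degin_ge0 B v.
rewrite ler_norml /degA => ? ? ? ?; apply/andP; split; lra.
Qed.

Lemma degB_ge u : u \in B -> (3 / 4) * D <= degB u.
Proof.
move=> /degB_dev; rewrite ler_norml => /andP[_ H].
have : eps * D <= 8^-1 * D by rewrite ler_wpM2r // ltW.
lra.
Qed.

Lemma degA_ge v : v \in A -> (3 / 4) * b <= degA v.
Proof.
move=> /degA_dev; rewrite ler_norml => /andP[_ H].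
have : eps * b <= 8^-1 * b by rewrite ler_wpM2r // ltW.
by move: b0; lra.
Qed.

Hypothesis Hspec : `|\sum_(u in B) \sum_(v in B) ((e u v)%:R - p) * g u * g v|
  <= eps * D * \sum_(u in B) g u ^+ 2.
Hypothesis Horth : \sum_(u in B) degB u * g u + \sum_(v in A) degA v * h v = 0.

(* Up to small errors the adjacency form is [p GB^2 + 2 GB HA] with
   [D GB + b HA] almost zero, and this is at most zero. *)
Lemma link_form_le :
  \sum_(u in B) \sum_(v in B) (e u v)%:R * g u * g v +
  \sum_(u in A) \sum_(v in A) (e u v)%:R * h u * h v +
  2 * \sum_(u in B) \sum_(v in A) (1 - (e u v)%:R) * g u * h v <=
  4 * eps * (\sum_(u in B) degB u * g u ^+ 2 + \sum_(v in A) degA v * h v ^+ 2).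
Proof.
set GB := \sum_(u in B) g u; set HA := \sum_(v in A) h v.
set gg := \sum_(u in B) g u ^+ 2; set hh := \sum_(v in A) h v ^+ 2.
have gg0 : 0 <= gg by apply: sumr_ge0 => ? _; apply: sqr_ge0.
have hh0 : 0 <= hh by apply: sumr_ge0 => ? _; apply: sqr_ge0.
have a0 : 0 <= a by apply: ler0n.
have [D0' b0' eps0'] : [/\ 0 <= D, 0 <= b & 0 <= eps] by split; exact: ltW.
have sumBB : \sum_(u in B) \sum_(v in B) ((e u v)%:R - p) * g u * g v =
    \sum_(u in B) \sum_(v in B) (e u v)%:R * g u * g v - p * GB ^+ 2.
  rewrite expr2 mulr_suml mulr_sumr -sumrB; apply: eq_bigr => u _.
  rewrite mulrA mulr_sumr -sumrB; apply: eq_bigr => v _; ring.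
have sumAB : \sum_(u in B) \sum_(v in A) (1 - (e u v)%:R) * g u * h v =
    GB * HA - \sum_(u in B) \sum_(v in A) (e u v)%:R * g u * h v.
  rewrite mulr_suml -sumrB; apply: eq_bigr => u _.
  rewrite mulr_sumr -sumrB; apply: eq_bigr => v _; ring.
have BA_le : \sum_(u in B) degin A u * g u ^+ 2 <= eps * D * gg.
  by rewrite mulr_sumr; apply: ler_sum => u /HBA ?; rewrite ler_wpM2r ?sqr_ge0.
have AB_le : \sum_(v in A) degin B v * h v ^+ 2 <= eps * b * hh.
  by rewrite mulr_sumr; apply: ler_sum => u /HAB ?; rewrite ler_wpM2r ?sqr_ge0.
have AA_le : \sum_(v in A) degin A v * h v ^+ 2 <= eps * b * hh.
  by rewrite mulr_sumr; apply: ler_sum => u /HAA ?; rewrite ler_wpM2r ?sqr_ge0.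
have crossAB := cross_le A B g h.
have crossAA := cross_le A A h h.
have nAB := ler_norm (- \sum_(u in B) \sum_(v in A) (e u v)%:R * g u * h v).
have nAA := ler_norm (\sum_(u in A) \sum_(v in A) (e u v)%:R * h u * h v).
have nBB := ler_norm (\sum_(u in B) \sum_(v in B) ((e u v)%:R - p) * g u * g v).
rewrite normrN in nAB.
have degB_sum : (3 / 4) * D * gg <= \sum_(u in B) degB u * g u ^+ 2.
  by rewrite mulr_sumr; apply: ler_sum => u /degB_ge ?; rewrite ler_wpM2r ?sqr_ge0.
have degA_sum : (3 / 4) * b * hh <= \sum_(v in A) degA v * h v ^+ 2.
  by rewrite mulr_sumr; apply: ler_sum => u /degA_ge ?; rewrite ler_wpM2r ?sqr_ge0.
pose eB := \sum_(u in B) (D - degB u) * g u.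
pose eA := \sum_(v in A) (b - degA v) * h v.
(* By [Horth] the sums weighted by the exact degrees cancel, and only the deviations of the degrees
   remain. *)
have err : D * GB + b * HA = eB + eA.
  have -> : eB = D * GB - \sum_(u in B) degB u * g u.
    by rewrite mulr_sumr -sumrB; apply: eq_bigr => u _; rewrite mulrBl.
  have -> : eA = b * HA - \sum_(u in A) degA u * h u.
    by rewrite mulr_sumr -sumrB; apply: eq_bigr => u _; rewrite mulrBl.
  by move: Horth; lra.
have eB_le : eB ^+ 2 <= b * ((2 * eps * D) ^+ 2 * gg) by apply: deviation_sqr_le degB_dev.
have eA_le : eA ^+ 2 <= a * ((eps * b) ^+ 2 * hh) by apply: deviation_sqr_le degA_dev.
have main : p * GB ^+ 2 + 2 * (GB * HA) <= eps * (D * gg + b * hh).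
  have bD : 0 < b * D by rewrite mulr_gt0.
  rewrite -(ler_pM2l bD).
  (* Substitute [b * HA = E - D * GB] and complete the square: the left side is [E ^+ 2] minus a
     square and minus [D * a * GB ^+ 2]. *)
  have s1 : b * D * (p * GB ^+ 2 + 2 * (GB * HA)) <= (eB + eA) ^+ 2.
    have HAE : b * HA = eB + eA - D * GB by move: err; lra.
    have -> : b * D * (p * GB ^+ 2 + 2 * (GB * HA)) =
        D * (p * b * GB ^+ 2 + 2 * GB * (b * HA)) by ring.
    rewrite HAE; set E := eB + eA.
    have : 0 <= D * a * GB ^+ 2 by rewrite mulr_ge0 ?sqr_ge0 // mulr_ge0.
    have := sqr_ge0 (E - D * GB).
    have -> : p * b = D - a by rewrite /D; ring.
    have -> : D * ((D - a) * GB ^+ 2 + 2 * GB * (E - D * GB)) =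
      E ^+ 2 - (E - D * GB) ^+ 2 - D * a * GB ^+ 2 by ring.
    lra.
  apply: le_trans s1 _.
  have s2 : (eB + eA) ^+ 2 <= 2 * eB ^+ 2 + 2 * eA ^+ 2.
    by have := sqr_ge0 (eB - eA); rewrite sqrrB sqrrD; lra.
  apply: le_trans s2 _.
  have s3 : a * ((eps * b) ^+ 2 * hh) <= D * ((eps * b) ^+ 2 * hh).
    by rewrite ler_wpM2r ?mulr_ge0 ?sqr_ge0 // /D lerDr mulr_ge0.
  have s4 : b * ((2 * eps * D) ^+ 2 * gg) = 4 * eps * (eps * (b * D * (D * gg))) by ring.
  have s5 : D * ((eps * b) ^+ 2 * hh) = eps * (eps * (b * D * (b * hh))) by ring.
  have s6 : eps * (eps * (b * D * (D * gg))) <= 8^-1 * (eps * (b * D * (D * gg))).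
    by rewrite ler_wpM2r // !mulr_ge0.
  have s7 : eps * (eps * (b * D * (b * hh))) <= 8^-1 * (eps * (b * D * (b * hh))).
    by rewrite ler_wpM2r // !mulr_ge0.
  have s8 : 0 <= eps * (b * D * (b * hh)) by rewrite !mulr_ge0.
  have -> : b * D * (eps * (D * gg + b * hh)) =
    eps * (b * D * (D * gg)) + eps * (b * D * (b * hh)) by ring.
  lra.
have q1 : eps * ((3 / 4) * D * gg) <= eps * \sum_(u in B) degB u * g u ^+ 2.
  by rewrite ler_wpM2l.
have q2 : eps * ((3 / 4) * b * hh) <= eps * \sum_(v in A) degA v * h v ^+ 2.
  by rewrite ler_wpM2l.
have r1 : 0 <= eps * D * gg by rewrite !mulr_ge0.
have r2 : 0 <= eps * b * hh by rewrite !mulr_ge0.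
have spec := Hspec; rewrite -/gg sumBB in spec nBB.
rewrite sumAB !mulr2n in crossAB crossAA *.
move: spec nBB nAA nAB crossAB crossAA BA_le AB_le AA_le main q1 q2.
set P := p * GB ^+ 2; set Q := GB * HA; move: P Q => P Q.
lra.
Qed.
End LinkBound.

(** * Links in the separated deleted join *)

Section FlagStructure.
Variables (n : nat) (E : {set {set 'I_n}}).
Implicit Types (x y : 'I_n * bool) (F : {set ('I_n * bool)}) (i j : 'I_n) (s t : {set 'I_n}).

Definition compat x y :=
  if x.2 == y.2 then adj E x.1 y.1 else (x.1 != y.1) && ~~ adj E x.1 y.1.

Lemma adj_sym : symmetric (adj E).
Proof. by move=> i j; rewrite /adj eq_sym setUC. Qed.

Lemma adj_irr i : adj E i i = false.
Proof. by rewrite /adj eqxx. Qed.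

Lemma compat_sym : symmetric compat.
Proof. by move=> x y; rewrite /compat eq_sym adj_sym (eq_sym x.1). Qed.

Lemma compat_irr x : compat x x = false.
Proof. by rewrite /compat eqxx adj_irr. Qed.

Definition side c F : {set 'I_n} := [set i | (i, c) \in F].

Lemma card_side F : (#|side false F| + #|side true F| = #|F|)%N.
Proof.
have emb c : #|side c F| = #|[set x in F | x.2 == c]|.
  rewrite -(card_imset _ (f := fun i => (i, c))); last by move=> i j [].
  apply: eq_card => -[i b]; rewrite !inE /=; apply/imsetP/andP.
    by case=> j; rewrite inE => jF [-> ->].
  by case=> iF /eqP <-; exists i; rewrite ?inE.
rewrite !emb -(cardsID [set x | x.2 == false] F); congr (_ + _)%N; apply: eq_card => -[i b];
  by rewrite !inE /=; case: b; rewrite ?andbT ?andbF.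
Qed.

(** The complex is flag: it is the clique complex of the graph [compat]. Links are therefore
    determined by pairwise conditions. *)
Lemma ZtP F : reflect (forall x y, x \in F -> y \in F -> x != y -> compat x y) (F \in Zt E).
Proof.
rewrite inE /is_clique; apply: (iffP and4P).
  case=> /forall_inP c0 /forall_inP c1 /pred0P dj /forall_inP cr [i b] [j c] iF jF ne.
  rewrite /compat /=; have [e|ne'] := eqVneq b c.
    subst c; have ij : i != j by apply: contraNneq ne => ->.
    case: b iF jF {ne} => iF jF.
      by have := c1 i; rewrite inE => /(_ iF)/forall_inP/(_ j); rewrite inE => /(_ jF)/implyP; apply.
    by have := c0 i; rewrite inE => /(_ iF)/forall_inP/(_ j); rewrite inE => /(_ jF)/implyP; apply.
  case: b c ne' iF jF {ne} => -[] // _ iF jF.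
    have ij : i != j.
      by apply/negP => /eqP e; have := dj i; rewrite /= !inE {1}e jF iF.
    rewrite ij /= adj_sym; have := cr j; rewrite inE => /(_ jF)/forall_inP/(_ i).
    by rewrite inE => /(_ iF).
  have ij : i != j.
    by apply/negP => /eqP e; have := dj i; rewrite /= !inE iF {1}e jF.
  by rewrite ij /=; have := cr i; rewrite inE => /(_ iF)/forall_inP/(_ j); rewrite inE; apply.
move=> H; split.
- apply/forall_inP => i; rewrite inE => iF; apply/forall_inP => j; rewrite inE => jF.
  apply/implyP => ij; have := H _ _ iF jF; rewrite /compat eqxx; apply.
  by apply: contraNneq ij => -[->].
- apply/forall_inP => i; rewrite inE => iF; apply/forall_inP => j; rewrite inE => jF.
  apply/implyP => ij; have := H _ _ iF jF; rewrite /compat eqxx; apply.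
  by apply: contraNneq ij => -[->].
- apply/pred0P => i /=; rewrite !inE; apply/negP => /andP[iF jF].
  by have := H _ _ iF jF; rewrite /compat /= eqxx xpair_eqE andbF => /(_ isT).
apply/forall_inP => i; rewrite inE => iF; apply/forall_inP => j; rewrite inE => jF.
by have := H _ _ iF jF; rewrite /compat /= xpair_eqE andbF => /(_ isT) /andP[].
Qed.

Lemma Zt_complex : is_simplicial_complex (Zt E).
Proof.
apply/forall_inP => F /ZtP HF; apply/forallP => G; apply/implyP => /subsetP GF.
by apply/ZtP => x y xG yG; apply: HF; apply: GF.
Qed.

Lemma vlinkE F x : F \in Zt E -> (x \in vlink (Zt E) F) = [forall y in F, compat x y].
Proof.
move=> /ZtP HF; rewrite inE; apply/andP/forall_inP.
  case=> xF /ZtP H y yF; apply: H; rewrite ?inE ?eqxx ?yF ?orbT //.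
  by apply: contraNneq xF => ->.
move=> H; split; first by apply/negP => /H; rewrite compat_irr.
apply/ZtP => y z; rewrite !inE => /orP[/eqP ->|yF] /orP[/eqP ->|zF]; rewrite ?eqxx //.
- by move=> _; apply: H.
- by move=> _; rewrite compat_sym H.
- exact: HF.
Qed.

Lemma vlink_setU1 F x y : F \in Zt E -> x \in vlink (Zt E) F ->
  (y \in vlink (Zt E) (x |: F)) = (y \in vlink (Zt E) F) && compat x y.
Proof.
move=> FZ xl; have xFZ : x |: F \in Zt E by move: xl; rewrite inE => /andP[].
rewrite !vlinkE // andbC; apply/forall_inP/andP.
  move=> H; split; first by rewrite compat_sym H // !inE eqxx.
  by apply/forall_inP => z zF; rewrite H // !inE zF orbT.
case=> cxy /forall_inP H z; rewrite !inE => /orP[/eqP ->|/H //].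
by rewrite compat_sym.
Qed.

Definition nb (s : {set 'I_n}) : {set 'I_n} := [set w | [forall z in s, adj E w z]].

Definition nb2 (s t : {set 'I_n}) : {set 'I_n} :=
  [set w in nb s | [forall z in t, (w != z) && ~~ adj E w z]].

Lemma nbP s w : reflect (forall z, z \in s -> adj E w z) (w \in nb s).
Proof. by rewrite inE; apply: forall_inP. Qed.

Lemma nb2P s t w : reflect ((forall z, z \in s -> adj E w z) /\
    (forall z, z \in t -> w != z /\ ~~ adj E w z)) (w \in nb2 s t).
Proof.
rewrite inE; apply: (iffP andP).
  by case=> /nbP H1 /forall_inP H2; split=> // z /H2 /andP.
by case=> H1 H2; split; [apply/nbP|apply/forall_inP => z /H2 /andP].
Qed.

Lemma nb_notin s w : w \in nb s -> w \notin s.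
Proof. by move/nbP => H; apply/negP => /H; rewrite adj_irr. Qed.

Lemma nb_sub s t : s \subset t -> nb t \subset nb s.
Proof. by move/subsetP => st; apply/subsetP => w /nbP H; apply/nbP => z /st /H. Qed.

Lemma nb2_sub s t : nb2 s t \subset nb s.
Proof. by apply/subsetP => w; rewrite inE => /andP[]. Qed.

Lemma nb2_notin_l s t w : w \in nb2 s t -> w \notin s.
Proof. by move/(subsetP (nb2_sub s t)); apply: nb_notin. Qed.

Lemma nb2_notin_r s t w : w \in nb2 s t -> w \notin t.
Proof. by case/nb2P => _ H; apply/negP => /H[]; rewrite eqxx. Qed.

(** Degrees inside a set [nb2] are again sizes of such sets, so size estimates also control
    degrees. *)
Lemma nb2_setU1 u s t : [set v in nb2 s t | adj E u v] = nb2 (u |: s) t.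
Proof.
apply/setP => v; rewrite inE; apply/andP/nb2P.
  case=> /nb2P[H1 H2] uv; split=> // z; rewrite !inE => /orP[/eqP ->|]; last exact: H1.
  by rewrite adj_sym.
case=> H1 H2; split; last by rewrite adj_sym H1 // !inE eqxx.
by apply/nb2P; split=> // z zs; apply: H1; rewrite !inE zs orbT.
Qed.

Lemma nb_nbr_sub u (s : {set 'I_n}) (C : {set 'I_n}) : C \subset nb s ->
  [set v in C | adj E u v] \subset nb (u |: s).
Proof.
move/subsetP => CA; apply/subsetP => v; rewrite inE => /andP[/CA /nbP H uv].
by apply/nbP => z; rewrite !inE => /orP[/eqP ->|/H //]; rewrite adj_sym.
Qed.

(** Any element of [s] or [t] would have to be both adjacent and non-adjacent to [w]. *)
Lemma nb2_disjoint s t w : (0 < #|s| + #|t|)%N -> w \in nb2 s t -> w \in nb2 t s -> False.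
Proof.
move=> st /nb2P[H1 H2] /nb2P[H3 H4].
have [s0|[z zs]] := set_0Vmem s.
  have [t0|[z zt]] := set_0Vmem t; first by rewrite s0 t0 cards0 in st.
  by have [_] := H2 z zt; rewrite H3.
by have [_] := H4 z zs; rewrite H1.
Qed.

Lemma mem_vlink F i c : F \in Zt E ->
  ((i, c) \in vlink (Zt E) F) = (i \in nb2 (side c F) (side (~~ c) F)).
Proof.
move=> FZ; rewrite vlinkE //; apply/forall_inP/nb2P.
  move=> H; split=> z; rewrite inE => zF; have := H _ zF; rewrite /compat /= ?eqxx //.
  by case: (c) => /= /andP[].
case=> H1 H2 [j b] jF; rewrite /compat /=; have [e|ne] := eqVneq c b.
  by rewrite H1 // inE e.
have bE : b = ~~ c by case: c b ne {H1 H2 jF} => -[].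
by have [|-> ->] := H2 j; rewrite // inE -bE.
Qed.

Lemma sum_pair_side (R : nmodType) (c : bool) (P : pred ('I_n * bool)) (H : 'I_n * bool -> R) :
  \sum_(x | P x) H x = \sum_(i | P (i, c)) H (i, c) + \sum_(i | P (i, ~~ c)) H (i, ~~ c).
Proof.
rewrite big_mkcond /= [\sum_(i | P (i, c)) _]big_mkcond [\sum_(i | P (i, ~~ c)) _]big_mkcond /=.
rewrite (eq_bigr (fun x => (fun i b => if P (i, b) then H (i, b) else 0) x.1 x.2));
  last by case.
rewrite -(pair_bigA _ (fun i b => if P (i, b) then H (i, b) else 0)) /= -big_split /=.
apply: eq_bigr => i _; rewrite big_bool; case: c => //=; exact: addrC.
Qed.
End FlagStructure.

(** Errors are relative to the expected sizes [n%:R * p ^+ m]. The third clause is a spectral norm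
    bound stated through the quadratic form; its diagonal is left out so that only centred edge
    indicators occur. *)
Definition pseudorandom (R : realFieldType) n (E : {set {set 'I_n}}) (p dl : R) (d : nat) : Prop :=
  [/\ forall s : {set 'I_n}, (#|s| <= d)%N ->
        `|#|nb E s|%:R - n%:R * p ^+ #|s| | <= dl * (n%:R * p ^+ #|s|),
      forall s : {set 'I_n}, #|s| = d.+1 -> #|nb E s|%:R <= dl * (n%:R * p ^+ d) &
      forall (s : {set 'I_n}) (f : 'I_n -> R), (#|s| < d)%N ->
        `|\sum_(u in nb E s) \sum_(v in nb E s | v != u) ((adj E u v)%:R - p) * f u * f v|
        <= dl * (n%:R * p ^+ #|s|.+1) * \sum_(u in nb E s) f u ^+ 2].

(** Here [s] and [t] are the sizes of the two sides of a face with [k] vertices. From [k >= 2d-1], a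
    smaller side below [d] forces the other to reach [d]; from [k <= 2d], a smaller side of size at
    least [d] forces both to equal [d]. *)
Lemma balanced_split s t k d : (0 < d)%N -> (s + t = k)%N ->
  ((k == 2 * d) || (k == 2 * d - 1))%N -> (s <= t)%N ->
  ((s < d)%N /\ (d <= t)%N \/ s = d /\ t = d) /\ (t <= 2 * d)%N.
Proof. by move=> d0 st /orP[] /eqP kE le; lia. Qed.

(** * From pseudorandomness of the graph to Garland's local condition *)

Section Links.
Variables (R : realFieldType) (n : nat) (E : {set {set 'I_n}}).
Implicit Types (F : {set ('I_n * bool)}).

Section Forms.
Variables (F : {set ('I_n * bool)}) (c : bool).
Hypotheses (FZ : F \in Zt E) (F0 : (0 < #|F|)%N).
Let B := nb2 E (side c F) (side (~~ c) F).
Let A := nb2 E (side (~~ c) F) (side c F).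

Let disj i : i \in B -> i \in A -> False.
Proof.
apply: nb2_disjoint; move: F0; rewrite -card_side.
by case: (c) => /=; rewrite // addnC.
Qed.

Lemma vlink_sum (H : 'I_n * bool -> R) :
  \sum_(x in vlink (Zt E) F) H x = \sum_(i in B) H (i, c) + \sum_(i in A) H (i, ~~ c).
Proof.
rewrite (sum_pair_side c); congr (_ + _); apply: eq_bigl => i; rewrite mem_vlink //.
by rewrite negbK.
Qed.

Lemma vlink_sum2 x (H : 'I_n * bool -> R) : x \in vlink (Zt E) F ->
  \sum_(y in vlink (Zt E) (x |: F)) H y =
  \sum_(i in B) (compat E x (i, c))%:R * H (i, c) +
  \sum_(i in A) (compat E x (i, ~~ c))%:R * H (i, ~~ c).
Proof.
move=> xl; rewrite -(vlink_sum (fun y => (compat E x y)%:R * H y)).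
rewrite big_mkcond [RHS]big_mkcond /=; apply: eq_bigr => y _.
rewrite vlink_setU1 //; case: (y \in _) => //=.
by case: (compat E x y); rewrite ?mul1r ?mul0r.
Qed.

Lemma compat_same i j (b : bool) : compat E (i, b) (j, b) = adj E i j.
Proof. by rewrite /compat /= eqxx. Qed.

(** Across the two sides the link graph is the complement of the graph; disjointness of [A] and [B]
    supplies [i != j]. *)
Lemma compat_diff i j b : i != j -> ((compat E (i, b) (j, ~~ b))%:R = 1 - (adj E i j)%:R :> R) *
  ((compat E (i, ~~ b) (j, b))%:R = 1 - (adj E i j)%:R :> R).
Proof.
move=> ij; rewrite /compat /= ij; split; case: b => /=; case: (adj E i j) => /=;
  by rewrite ?subr0 ?subrr.
Qed.

Let neBA i j : i \in B -> j \in A -> i != j.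
Proof. by move=> iB jA; apply/eqP => ij; apply: (disj iB); rewrite ij. Qed.

Lemma vlink_degB i : i \in B -> #|vlink (Zt E) ((i, c) |: F)|%:R =
  degin R (adj E) B i + (#|A|%:R - degin R (adj E) A i).
Proof.
move=> iB; have il : (i, c) \in vlink (Zt E) F by rewrite mem_vlink.
rewrite -sum1_card natr_sum (vlink_sum2 (fun=> 1%:R)) // !deginE; congr (_ + _).
  by apply: eq_bigr => j _; rewrite compat_same mulr1.
rewrite -sum1_card natr_sum -sumrB; apply: eq_bigr => j jA.
by rewrite mulr1 (compat_diff _ (neBA iB jA)).
Qed.

Lemma vlink_degA i : i \in A -> #|vlink (Zt E) ((i, ~~ c) |: F)|%:R =
  degin R (adj E) A i + (#|B|%:R - degin R (adj E) B i).
Proof.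
move=> iA; have il : (i, ~~ c) \in vlink (Zt E) F by rewrite mem_vlink // negbK.
rewrite -sum1_card natr_sum (vlink_sum2 (fun=> 1%:R)) // !deginE addrC; congr (_ + _).
  by apply: eq_bigr => j _; rewrite compat_same mulr1.
rewrite -sum1_card natr_sum -sumrB; apply: eq_bigr => j jB.
by rewrite mulr1 (compat_diff _ _) // eq_sym neBA.
Qed.

Lemma vlink_form (f : 'I_n * bool -> R) :
  \sum_(x in vlink (Zt E) F) \sum_(y in vlink (Zt E) (x |: F)) f x * f y =
  \sum_(u in B) \sum_(v in B) (adj E u v)%:R * f (u, c) * f (v, c) +
  \sum_(u in A) \sum_(v in A) (adj E u v)%:R * f (u, ~~ c) * f (v, ~~ c) +
  2 * \sum_(u in B) \sum_(v in A) (1 - (adj E u v)%:R) * f (u, c) * f (v, ~~ c).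
Proof.
rewrite (eq_bigr (fun x => \sum_(i in B) (compat E x (i, c))%:R * (f x * f (i, c)) +
  \sum_(i in A) (compat E x (i, ~~ c))%:R * (f x * f (i, ~~ c)))); last first.
  by move=> x xl; rewrite (vlink_sum2 (fun y => f x * f y)).
rewrite vlink_sum !big_split /=.
have -> : \sum_(i in B) \sum_(j in B) (compat E (i, c) (j, c))%:R * (f (i, c) * f (j, c)) =
  \sum_(u in B) \sum_(v in B) (adj E u v)%:R * f (u, c) * f (v, c).
  by apply: eq_bigr => i _; apply: eq_bigr => j _; rewrite compat_same mulrA.
have -> : \sum_(i in A) \sum_(j in A) (compat E (i, ~~ c) (j, ~~ c))%:R * (f (i, ~~ c) * f (j, ~~ c)) =
  \sum_(u in A) \sum_(v in A) (adj E u v)%:R * f (u, ~~ c) * f (v, ~~ c).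
  by apply: eq_bigr => i _; apply: eq_bigr => j _; rewrite compat_same mulrA.
have -> : \sum_(i in B) \sum_(j in A) (compat E (i, c) (j, ~~ c))%:R * (f (i, c) * f (j, ~~ c)) =
  \sum_(u in B) \sum_(v in A) (1 - (adj E u v)%:R) * f (u, c) * f (v, ~~ c).
  apply: eq_bigr => i iB; apply: eq_bigr => j jA.
  by rewrite (compat_diff _ (neBA iB jA)) mulrA.
have -> : \sum_(i in A) \sum_(j in B) (compat E (i, ~~ c) (j, c))%:R * (f (i, ~~ c) * f (j, c)) =
  \sum_(u in B) \sum_(v in A) (1 - (adj E u v)%:R) * f (u, c) * f (v, ~~ c).
  rewrite exchange_big; apply: eq_bigr => i iB; apply: eq_bigr => j jA.
  rewrite (compat_diff _ _) 1?eq_sym ?neBA // adj_sym; ring.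
ring.
Qed.
End Forms.

Section Local.
Variables (p dl eps : R) (d : nat).
Hypotheses (d0 : (0 < d)%N) (p0 : 0 < p) (pdl : p <= dl) (eps8 : eps <= 8^-1).
Hypothesis dl_eps : 4 * (6 * d%:R + 1) * dl <= eps.
Let q s : R := n%:R * p ^+ s.
Hypothesis qd : 1 <= dl * q d.
Hypothesis HE : pseudorandom E p dl d.

Let dl0 : 0 < dl. Proof. exact: lt_le_trans pdl. Qed.
Let d1 : 1 <= d%:R :> R. Proof. by rewrite ler1n. Qed.
(** The constant is [4 * (6 * d + 1)] at the smallest value [d = 1]. *)
Let dlc : 28 * dl <= eps.
Proof. by apply: le_trans dl_eps; rewrite ler_wpM2r ?(ltW dl0) //; move: d1; lra. Qed.
Let qS s : q s.+1 = p * q s. Proof. by rewrite /q exprS mulrCA. Qed.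
Let q_ge0 s : 0 <= q s. Proof. by rewrite mulr_ge0 ?ler0n ?exprn_ge0 // ltW. Qed.
Let dl1 : dl <= 1. Proof. by move: dlc eps8; lra. Qed.
Let q_mono s t : (s <= t)%N -> q t <= q s.
Proof.
move=> st; rewrite ler_wpM2l ?ler0n // -(subnK st) exprD ler_piMl ?exprn_ge0 ?(ltW p0) //.
by rewrite exprn_ile1 ?(ltW p0) // (le_trans pdl dl1).
Qed.
Let qge s : (s <= d)%N -> 1 <= dl * q s.
Proof. by move=> sd; apply: le_trans qd _; rewrite ler_wpM2l ?q_mono ?ltW. Qed.
Let qgt0 s : (s <= d)%N -> 0 < q s.
Proof. by move/qge; rewrite lt_neqAle q_ge0 andbT; case: eqP => // <-; rewrite mulr0; lra. Qed.
Let qSle s : q s.+1 <= dl * q s.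
Proof. by rewrite qS ler_wpM2r. Qed.

Let nb_up (s : {set 'I_n}) : (#|s| <= d)%N -> #|nb E s|%:R <= (1 + dl) * q #|s|.
Proof. by case: HE => H _ _ /H; rewrite ler_norml => /andP[_]; rewrite -/(q _); lra. Qed.

Let nb_small (s : {set 'I_n}) : (d < #|s|)%N -> #|nb E s|%:R <= dl * q d.
Proof.
move=> ds; have : (0 < #|[set t : {set 'I_n} | (t \subset s) && (#|t| == d.+1)]|)%N.
  by rewrite cards_draws bin_gt0.
rewrite card_gt0 => /set0Pn[t]; rewrite inE => /andP[ts /eqP td].
case: HE => _ H _; apply: le_trans (H t td).
by rewrite ler_nat subset_leq_card // nb_sub.
Qed.

(** Below size [d] one more vertex costs a factor of about [p], which is at most [dl]; at size [d]
    the second clause of [pseudorandom] applies. *)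
Let nb_succ (s : {set 'I_n}) z : (#|s| <= d)%N -> z \notin s ->
  #|nb E (z |: s)|%:R <= 2 * dl * q #|s|.
Proof.
move=> sd zs; have c : #|z |: s| = #|s|.+1 by rewrite cardsU1 zs.
have [sd'|] := leqP #|s|.+1 d.
  have := @nb_up (z |: s); rewrite c => /(_ sd') H; apply: le_trans H _.
  have := qSle #|s|; have := q_ge0 #|s|.+1.
  have : dl * q #|s|.+1 <= 1 * q #|s|.+1 by rewrite ler_wpM2r.
  lra.
move=> ds; have sE : #|s| = d by apply/eqP; rewrite eqn_leq sd.
have := @nb_small (z |: s); rewrite c sE => /(_ (ltnSn _)) H; apply: le_trans H _.
have : 0 <= dl * q d by rewrite mulr_ge0 // ltW.
lra.
Qed.

Let nb2_up (s t : {set 'I_n}) : (#|s| <= d)%N -> #|nb2 E s t|%:R <= (1 + dl) * q #|s|.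
Proof.
move=> sd; apply: le_trans (nb_up sd); by rewrite ler_nat subset_leq_card // nb2_sub.
Qed.

(** Each of at most [2 * d] vertices of [t] removes itself and its neighbours, at most
    [3 * dl * q #|s|] in total: [2 * dl] from [nb_succ], and one vertex absorbed by [qd]. Adding the
    error in the size of [nb E s] gives [6 * d + 1]. *)
Let nb2_low (s t : {set 'I_n}) : (#|s| <= d)%N -> (#|t| <= 2 * d)%N -> [disjoint s & t] ->
  (1 - (6 * d%:R + 1) * dl) * q #|s| <= #|nb2 E s t|%:R.
Proof.
move=> sd td dj.
have sub : nb E s \subset nb2 E s t :|: \bigcup_(z in t) (z |: nb E (z |: s)).
  apply/subsetP => w wn; rewrite inE; case: (boolP (w \in nb2 _ _ _)) => //= nw.
  move: nw; rewrite inE wn /= negb_forall_in => /exists_inP[z zt].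
  rewrite negb_and !negbK => wz; apply/bigcupP; exists z => //; rewrite !inE.
  case/orP: wz => [/eqP ->|wz]; first by rewrite eqxx.
  apply/orP; right; apply/forall_inP => y; rewrite !inE => /orP[/eqP -> //|ys].
  by move/nbP: wn; apply.
have U : #|nb E s|%:R <= #|nb2 E s t|%:R + \sum_(z in t) (3 * dl * q #|s|).
  apply: le_trans (_ : (#|nb2 E s t|%:R + \sum_(z in t) #|z |: nb E (z |: s)|%:R) <= _).
    rewrite -natr_sum -natrD ler_nat.
    apply: leq_trans (subset_leq_card sub) _; apply: leq_trans (leq_card_setU _ _) _.
    rewrite leq_add2l; apply: (big_ind2 (fun (X : {set 'I_n}) m => (#|X| <= m)%N)) => //.
      by rewrite cards0.
    by move=> X m Y k Xm Yk; apply: leq_trans (leq_card_setU _ _) (leq_add Xm Yk).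
  rewrite lerD2l; apply: ler_sum => z zt.
  have zs : z \notin s by apply/negP => zs; move/pred0P/(_ z): dj; rewrite /= zs zt.
  have := nb_succ sd zs; have := qge sd.
  have : #|z |: nb E (z |: s)|%:R <= 1 + #|nb E (z |: s)|%:R :> R.
    by rewrite cardsU1 natrD lerD2r lern1 leq_b1.
  lra.
move: U; rewrite sumr_const -[_ *+ #|t|]mulr_natl => U.
have : #|t|%:R * (3 * dl * q #|s|) <= (2 * d%:R) * (3 * dl * q #|s|).
  apply: ler_wpM2r; last by rewrite -natrM ler_nat.
  by rewrite mulr_ge0 ?q_ge0 // mulr_ge0 // ltW.
case: HE => H _ _; move: (H s sd); rewrite ler_norml -/(q _) => /andP[H1 _].
lra.
Qed.
Let degin_le (s C : {set 'I_n}) u : C \subset nb E s ->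
  degin R (adj E) C u <= #|nb E (u |: s)|%:R.
Proof. by move=> Cs; rewrite ler_nat subset_leq_card // nb_nbr_sub. Qed.

Let degin_small (s C : {set 'I_n}) u : (d <= #|s|)%N -> u \notin s -> C \subset nb E s ->
  degin R (adj E) C u <= dl * q d.
Proof.
move=> ds us Cs; apply: le_trans (degin_le _ Cs) _; apply: nb_small.
by rewrite cardsU1 us.
Qed.

Section Face.
Variables (s t : {set 'I_n}) (g h : 'I_n -> R).
Hypotheses (dj : [disjoint s & t]) (td : (#|t| <= 2 * d)%N).
Hypothesis st : (#|s| < d)%N /\ (d <= #|t|)%N \/ #|s| = d /\ #|t| = d.
Let B := nb2 E s t.
Let A := nb2 E t s.
Let b : R := #|B|%:R.
Let a : R := #|A|%:R.
Let D := p * b + a.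

Let sd : (#|s| <= d)%N. Proof. by case: st => -[] => [/ltnW //|->]. Qed.
Let td' : (d <= #|t|)%N. Proof. by case: st => -[] // _ ->. Qed.
Let half x y : 0 <= y -> (1 - (6 * d%:R + 1) * dl) * y <= x -> y <= 2 * x.
Proof.
move=> y0 H; have : (6 * d%:R + 1) * dl * y <= 2^-1 * y.
  by rewrite ler_wpM2r //; move: dl_eps eps8; lra.
lra.
Qed.
Let b_low : q #|s| <= 2 * b. Proof. exact/half/nb2_low. Qed.
Let b0 : 0 < b. Proof. by move: b_low (qgt0 sd); lra. Qed.
Let a0 : 0 <= a. Proof. exact: ler0n. Qed.
Let pb0 : 0 < p * b. Proof. exact: mulr_gt0. Qed.
Let D0 : 0 < D. Proof. by move: pb0 a0; rewrite /D; lra. Qed.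
Let eps_ge : 0 < eps. Proof. by move: dlc dl0; lra. Qed.
Let eps_mul c y : 0 <= y -> 0 <= c -> c <= 28 -> c * dl * y <= eps * y.
Proof.
move=> y0 c0 c28; rewrite ler_wpM2r //; apply: le_trans dlc.
by rewrite ler_wpM2r // ltW.
Qed.
(** If [s] has fewer than [d] vertices, the term [p * b] of [D] is already large enough; if both
    sides have [d] vertices, the term [a] is. *)
Let D_low : q d <= 2 * D /\ ((#|s| < d)%N -> q #|s|.+1 <= 2 * (p * b)).
Proof.
split; last by rewrite qS => _; have := ler_wpM2l (ltW p0) b_low; lra.
have pb_low : p * q #|s| <= p * (2 * b) by rewrite ler_wpM2l // ltW.
case: st => -[s1 t1].
  have := q_mono s1; rewrite qS; move: pb_low a0; rewrite /D; lra.
have : q #|t| <= 2 * a.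
  by apply/half/nb2_low; rewrite ?q_ge0 ?t1 ?s1 // ?leq_pmull // disjoint_sym.
by rewrite t1; move: pb0; rewrite /D; lra.
Qed.
Let AB_notin u : u \in B -> u \notin t /\ u \notin s.
Proof. by move=> uB; rewrite (nb2_notin_r uB) (nb2_notin_l uB). Qed.
Let BA_notin u : u \in A -> u \notin t /\ u \notin s.
Proof. by move=> uB; rewrite (nb2_notin_r uB) (nb2_notin_l uB). Qed.

Let HBA u : u \in B -> degin R (adj E) A u <= eps * D.
Proof.
case/AB_notin => ut us; apply: le_trans (degin_small td' ut (nb2_sub _ _ _)) _.
have [H _] := D_low; have := ler_wpM2l (ltW dl0) H.
have := @eps_mul 2 D (ltW D0); lra.
Qed.

Let qd_b : dl * q d <= eps * b.
Proof.
have := ler_wpM2l (ltW dl0) (le_trans (q_mono sd) b_low).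
have := @eps_mul 2 b (ltW b0); lra.
Qed.

Let HAA v : v \in A -> degin R (adj E) A v <= eps * b.
Proof.
by case/BA_notin => vt _; apply: le_trans (degin_small td' vt (nb2_sub _ _ _)) qd_b.
Qed.

Let HAB v : v \in A -> degin R (adj E) B v <= eps * b.
Proof.
case/BA_notin => _ vs; apply: le_trans (degin_le _ (nb2_sub _ _ _)) _.
apply: le_trans (nb_succ sd vs) _; have := ler_wpM2l (ltW dl0) b_low.
have := @eps_mul 4 b (ltW b0); lra.
Qed.

(** For [#|s| < d] the degree is the size of [nb2 E (u |: s) t], which is concentrated. For
    [#|s| = d] no concentration is available, but the degree and [p * b] are both small compared
    with [q d], hence with [D]. *)
Let HBB u : u \in B -> `|degin R (adj E) B u - p * b| <= eps * D.
Proof.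
move=> uB; have [ut us] := AB_notin uB; have [Dl Dl'] := D_low.
have bup := nb2_up t sd; rewrite -/B -/b in bup.
have pbup := ler_wpM2l (ltW p0) bup.
case: st => -[s1 t1].
  have c : #|u |: s| = #|s|.+1 by rewrite cardsU1 us.
  have dE : degin R (adj E) B u = #|nb2 E (u |: s) t|%:R by rewrite /degin nb2_setU1.
  have lo : (1 - (6 * d%:R + 1) * dl) * q #|s|.+1 <= degin R (adj E) B u.
    rewrite dE -c; apply: nb2_low => //; first by rewrite c.
    by rewrite disjoints_subset subUset sub1set inE ut -disjoints_subset.
  have up : degin R (adj E) B u <= (1 + dl) * q #|s|.+1.
    by rewrite dE -c; apply: nb2_up; rewrite c.
  have blo := ler_wpM2l (ltW p0) (nb2_low sd td dj); rewrite -/B -/b in blo.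
  have h1 := Dl' s1.
  have h2 : 4 * (6 * d%:R + 1) * dl * (p * b) <= eps * (p * b).
    by rewrite ler_wpM2r // ltW.
  have h3 : eps * (p * b) <= eps * D by rewrite ler_wpM2l ?(ltW eps_ge) // lerDl.
  have h4 : (6 * d%:R + 1) * dl * q #|s|.+1 <= (6 * d%:R + 1) * dl * (2 * (p * b)).
    by rewrite ler_wpM2l // mulr_ge0 ?(ltW dl0) //; move: d1; lra.
  have h5 : dl * q #|s|.+1 <= (6 * d%:R + 1) * dl * q #|s|.+1.
    by rewrite ler_wpM2r // ler_peMl ?(ltW dl0) //; move: d1; lra.
  rewrite qS in lo up h4 h5.
  rewrite ler_norml; apply/andP; split; lra.
have du : degin R (adj E) B u <= dl * q d.
  by apply: degin_small (nb2_sub _ _ _) => //; rewrite s1.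
have du0 := degin_ge0 R (adj E) B u.
have h1 : p * b <= dl * ((1 + dl) * q d).
  by apply: ler_pM; rewrite ?(ltW p0) ?(ltW b0) // -s1.
have h2 : (1 + dl) * q d <= 2 * (2 * D).
  have : dl * q d <= 1 * q d by rewrite ler_wpM2r.
  lra.
have h3 := ler_wpM2l (ltW dl0) h2; have h4 := ler_wpM2l (ltW dl0) Dl.
have := @eps_mul 4 D (ltW D0); have := pb0.
rewrite ler_norml => ? H; apply/andP; split; lra.
Qed.

Let Hspec : `|\sum_(u in B) \sum_(v in B) ((adj E u v)%:R - p) * g u * g v|
  <= eps * D * \sum_(u in B) g u ^+ 2.
Proof.
set gg := \sum_(u in B) g u ^+ 2.
have gg0 : 0 <= gg by apply: sumr_ge0 => ? _; apply: sqr_ge0.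
have [Dl Dl'] := D_low.
case: st => -[s1 t1].
  (* The spectral clause concerns all of [nb E s], so [g] is extended by zero. The diagonal restored
     afterwards costs [p * gg], which is absorbed by [qge]. *)
  pose f u := if u \in B then g u else 0.
  have sumf (H : 'I_n -> R -> R) (P : pred 'I_n) : (forall u, H u 0 = 0) ->
      \sum_(u in nb E s | P u) H u (f u) = \sum_(u in B | P u) H u (g u).
    move=> H0; rewrite big_mkcond [RHS]big_mkcond /=; apply: eq_bigr => u _.
    rewrite /f; case: (boolP (u \in B)) => uB; last by case: ifP; rewrite ?H0.
    by rewrite (subsetP (nb2_sub E s t)).
  have sumf0 (H : 'I_n -> R -> R) : (forall u, H u 0 = 0) ->
      \sum_(u in nb E s) H u (f u) = \sum_(u in B) H u (g u).
    move=> H0; have := sumf H xpredT H0.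
    by under eq_bigl do rewrite andbT; under [RHS]eq_bigl do rewrite andbT.
  have ff : \sum_(u in nb E s) f u ^+ 2 = gg.
    by rewrite (sumf0 (fun _ x => x ^+ 2)) // => _; rewrite expr0n.
  have SE : \sum_(u in B) \sum_(v in B) ((adj E u v)%:R - p) * g u * g v =
    \sum_(u in nb E s) \sum_(v in nb E s | v != u) ((adj E u v)%:R - p) * f u * f v - p * gg.
    have -> : \sum_(u in nb E s) \sum_(v in nb E s | v != u) ((adj E u v)%:R - p) * f u * f v
       = \sum_(u in B) \sum_(v in B | v != u) ((adj E u v)%:R - p) * g u * g v.
      rewrite (sumf0 (fun u x => \sum_(v in nb E s | v != u) ((adj E u v)%:R - p) * x * f v)).
        apply: eq_bigr => u _.
        by rewrite (sumf (fun v y => ((adj E u v)%:R - p) * g u * y)) // => v; rewrite mulr0.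
      by move=> u; rewrite big1 // => v _; rewrite mulr0 mul0r.
    rewrite mulr_sumr -sumrB; apply: eq_bigr => u uB.
    rewrite (bigD1 u) //= adj_irr addrC; congr (_ + _); rewrite mulr0n; ring.
  case: HE => _ _ /(_ s f s1); rewrite ff -/(q _) => H3.
  rewrite SE; apply: le_trans (ler_normB _ _) _.
  have h1 : `|p * gg| <= dl * q #|s|.+1 * gg.
    rewrite ger0_norm ?mulr_ge0 ?(ltW p0) // ler_wpM2r // qS mulrCA.
    by rewrite -[X in X <= _]mulr1 ler_wpM2l ?(ltW p0) // qge.
  have h2 : dl * q #|s|.+1 * gg <= dl * (2 * D) * gg.
    rewrite ler_wpM2r // ler_wpM2l ?(ltW dl0) //; apply: le_trans (Dl' s1) _.
    by rewrite ler_wpM2l // lerDl.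
  have h3 := @eps_mul 4 (D * gg) (mulr_ge0 (ltW D0) gg0).
  lra.
(* When [#|s| = d] the two parts are bounded separately: the adjacency form by the small degrees,
   the rank-one part by Cauchy-Schwarz. *)
have -> : \sum_(u in B) \sum_(v in B) ((adj E u v)%:R - p) * g u * g v =
    \sum_(u in B) \sum_(v in B) (adj E u v)%:R * g u * g v - p * (\sum_(u in B) g u) ^+ 2.
  rewrite expr2 mulr_suml mulr_sumr -sumrB; apply: eq_bigr => u _.
  rewrite mulrA mulr_sumr -sumrB; apply: eq_bigr => v _; ring.
apply: le_trans (ler_normB _ _) _.
have du u : u \in B -> degin R (adj E) B u <= dl * q d.
  by move=> /AB_notin[_ us]; apply: degin_small (nb2_sub _ _ _) => //; rewrite s1.
have h0 : \sum_(u in B) degin R (adj E) B u * g u ^+ 2 <= dl * q d * gg.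
  by rewrite mulr_sumr; apply: ler_sum => u /du ?; rewrite ler_wpM2r ?sqr_ge0.
have := cross_le (adj_sym E) B B g g; rewrite mulr2n => h1.
have h2 : `|p * (\sum_(u in B) g u) ^+ 2| <= dl * (2 * q d) * gg.
  rewrite ger0_norm; last by apply: mulr_ge0; [exact: ltW|exact: sqr_ge0].
  apply: le_trans (ler_wpM2l (ltW p0) (sqr_sum_le _ _)) _; rewrite -/b -/gg [X in X <= _]mulrA ler_wpM2r //.
  apply: ler_pM; rewrite ?(ltW p0) ?(ltW b0) //; have := nb2_up t sd; rewrite -/B -/b s1.
  have : dl * q d <= 1 * q d by rewrite ler_wpM2r.
  lra.
have h3 := @eps_mul 6 (D * gg) (mulr_ge0 (ltW D0) gg0).
have h4 : dl * q d * gg <= dl * (2 * D) * gg.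
  by rewrite ler_wpM2r // ler_wpM2l ?(ltW dl0).
lra.
Qed.

Lemma face_link_bound :
  [/\ forall u, u \in B -> 0 < degin R (adj E) B u + (a - degin R (adj E) A u),
      forall v, v \in A -> 0 < degin R (adj E) A v + (b - degin R (adj E) B v) &
  \sum_(u in B) (degin R (adj E) B u + (a - degin R (adj E) A u)) * g u +
  \sum_(v in A) (degin R (adj E) A v + (b - degin R (adj E) B v)) * h v = 0 ->
  \sum_(u in B) \sum_(v in B) (adj E u v)%:R * g u * g v +
  \sum_(u in A) \sum_(v in A) (adj E u v)%:R * h u * h v +
  2 * \sum_(u in B) \sum_(v in A) (1 - (adj E u v)%:R) * g u * h v <=
  4 * eps * (\sum_(u in B) (degin R (adj E) B u + (a - degin R (adj E) A u)) * g u ^+ 2 +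
    \sum_(v in A) (degin R (adj E) A v + (b - degin R (adj E) B v)) * h v ^+ 2)].
Proof.
split.
- move=> u uB; apply: lt_le_trans (degB_ge _ _ HBB HBA uB) => //.
  by apply: mulr_gt0 D0; lra.
- move=> v vA; apply: lt_le_trans (degA_ge _ _ HAA HAB vA) => //.
  by apply: mulr_gt0 b0; lra.
by apply: (link_form_le (adj_sym E) (ltW p0) eps_ge eps8 b0 D0 HBB HBA HAA HAB Hspec).
Qed.
End Face.

Lemma pseudorandom_garland k : ((k == 2 * d) || (k == 2 * d - 1))%N ->
  4 * eps <= k.+2%:R^-1 -> homology_vanishes (Zt E) k.
Proof.
move=> kd epsk.
have k0 : (0 < k)%N by clear -kd d0; lia.
(* The sign [c] marks the side of the face with fewer vertices, with ties going to [false]. *)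
have sides (F : {set ('I_n * bool)}) : #|F| = k -> exists c : bool,
    ((#|side c F| < d)%N /\ (d <= #|side (~~ c) F|)%N \/
     #|side c F| = d /\ #|side (~~ c) F| = d) /\ (#|side (~~ c) F| <= 2 * d)%N.
  move=> Fk; have := card_side F; rewrite Fk => Fs.
  have [le|lt] := leqP #|side false F| #|side true F|; [exists false|exists true].
    exact: (balanced_split d0 Fs kd le).
  by apply: (balanced_split d0 _ kd (ltnW lt)); rewrite addnC.
have dj (F : {set ('I_n * bool)}) c : F \in Zt E -> [disjoint side c F & side (~~ c) F].
  move=> /ZtP H; apply/pred0P => i /=; rewrite !inE; apply/negP => /andP[iF iF'].
  by have := H _ _ iF iF'; rewrite /compat /= eqxx xpair_eqE eqxx /=; case: (c) => /(_ isT).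
have loc (F : {set ('I_n * bool)}) (f : 'I_n * bool -> R) : F \in Zt E -> #|F| = k ->
  (forall x, x \in vlink (Zt E) F -> (0 < #|vlink (Zt E) (x |: F)|)%N) /\
  (\sum_(x in vlink (Zt E) F) #|vlink (Zt E) (x |: F)|%:R * f x = 0 ->
   \sum_(x in vlink (Zt E) F) \sum_(y in vlink (Zt E) (x |: F)) f x * f y <=
   k.+2%:R^-1 * \sum_(x in vlink (Zt E) F) #|vlink (Zt E) (x |: F)|%:R * f x ^+ 2).
  move=> FZ Fk; have F0 : (0 < #|F|)%N by rewrite Fk.
  have [c [cs ct]] := sides F Fk.
  have [pB pA bd] := face_link_bound (fun u => f (u, c)) (fun u => f (u, ~~ c)) (dj F c FZ) ct cs.
  have degs (H : 'I_n * bool -> R) : \sum_(x in vlink (Zt E) F) #|vlink (Zt E) (x |: F)|%:R * H x =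
    \sum_(u in nb2 E (side c F) (side (~~ c) F))
      (degin R (adj E) (nb2 E (side c F) (side (~~ c) F)) u +
       (#|nb2 E (side (~~ c) F) (side c F)|%:R - degin R (adj E) (nb2 E (side (~~ c) F) (side c F)) u))
      * H (u, c) +
    \sum_(u in nb2 E (side (~~ c) F) (side c F))
      (degin R (adj E) (nb2 E (side (~~ c) F) (side c F)) u +
       (#|nb2 E (side c F) (side (~~ c) F)|%:R - degin R (adj E) (nb2 E (side c F) (side (~~ c) F)) u))
      * H (u, ~~ c).
    rewrite (vlink_sum c FZ); congr (_ + _); apply: eq_bigr => u uS.
      by rewrite vlink_degB.
    by rewrite vlink_degA.
  split.
    case=> i b il; rewrite -(ltr0n R); have [e|e] := eqVneq b c.
      rewrite e in il *; rewrite vlink_degB //; first by apply: pB; rewrite -mem_vlink.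
      by rewrite -mem_vlink.
    have bE : b = ~~ c by case: (b) (c) e => -[].
    rewrite bE in il *; rewrite mem_vlink // negbK in il.
    by rewrite vlink_degA //; apply: pA.
  rewrite degs => /bd H; rewrite (vlink_form c FZ F0); apply: le_trans H _.
  rewrite (degs (fun x => f x ^+ 2)); apply: ler_wpM2r => //.
  by apply: addr_ge0; apply: sumr_ge0 => u uS; rewrite mulr_ge0 ?sqr_ge0 // ltW // ?pA ?pB.
apply: garland => //; first exact: Zt_complex.
  by move=> F x FZ Fk xl; have [H _] := loc F (fun=> 0) FZ Fk; apply: H.
(* Chains are rational while the estimates live in [R]; the order embedding [ratr] transfers the
   inequality. *)
move=> F f FZ Fk H0; have [_ H] := loc F (fun x => ratr (f x)) FZ Fk.
rewrite -(ler_rat R) rmorphM /= fmorphV /= ratr_nat !rmorph_sum /=.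
under eq_bigr => x _ do (rewrite rmorph_sum /=; under eq_bigr => y _ do rewrite rmorphM /=).
under [X in _ <= _ * X]eq_bigr => x _ do rewrite rmorphM /= ratr_nat rmorphXn /=.
apply: H; transitivity (ratr (0 : rat) : R); last by rewrite rmorph0.
rewrite -H0 rmorph_sum /=; apply: eq_bigr => x _.
by rewrite rmorphM /= ratr_nat.
Qed.
End Local.
End Links.

(** * Moments of random graphs *)

Lemma bin_le_exp m k : ('C(m, k) <= m ^ k)%N.
Proof.
elim: m k => [|m IH] [|k]; rewrite ?bin0 ?bin0n ?expn0 //.
rewrite binS (leq_trans (leq_add (IH _) (IH _))) // !expnS addnC -mulSn leq_mul //.
by case: k => // k; rewrite leq_exp2r.
Qed.

Section TupleSums.
Variables (R : realFieldType) (T : finType).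
Implicit Types (x : seq T).

Lemma sum_tupleS l (G : seq T -> R) :
  \sum_(x : l.+1.-tuple T) G x = \sum_w \sum_(y : l.-tuple T) G (w :: y).
Proof.
rewrite pair_bigA /= (reindex (fun wy : T * l.-tuple T => cons_tuple wy.1 wy.2)) //.
exists (fun x : l.+1.-tuple T => (thead x, [tuple of behead x])) => [[w y] _|x _] /=.
  by congr pair; apply: val_inj.
by rewrite [x in RHS]tuple_eta; apply: val_inj.
Qed.

Lemma sum_tuple0 (G : seq T -> R) : \sum_(x : 0.-tuple T) G x = G [::].
Proof.
rewrite (eq_bigr (fun=> G [::])); last by move=> x _; rewrite tuple0.
by rewrite sumr_const card_tuple expn0.
Qed.

Lemma expr_sum_tuple l (a : T -> R) :
  (\sum_w a w) ^+ l = \sum_(x : l.-tuple T) \prod_(w <- x) a w.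
Proof.
elim: l => [|l IH]; first by rewrite (sum_tuple0 (fun x => \prod_(w <- x) a w)) big_nil.
rewrite (sum_tupleS l (fun x => \prod_(w <- x) a w)) exprS mulr_suml; apply: eq_bigr => w _.
by rewrite IH mulr_sumr; apply: eq_bigr => y _; rewrite big_cons.
Qed.

Lemma prod_natb x (P : pred T) : \prod_(w <- x) (P w)%:R = (all P x)%:R :> R.
Proof.
by elim: x => [|w x IH]; rewrite ?big_nil ?big_cons //= IH -natrM mulnb.
Qed.

Lemma sum_tuple_in l (U : {set T}) :
  \sum_(x : l.-tuple T) (all (fun w => w \in U) x)%:R = #|U|%:R ^+ l :> R.
Proof.
under eq_bigr do rewrite -prod_natb.
rewrite -expr_sum_tuple; congr (_ ^+ _).
by rewrite -sum1_card natr_sum [RHS]big_mkcond; apply: eq_bigr => w _; case: (w \in U).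
Qed.

(** Group the tuples by their set of entries. There are at most [#|T| ^ u] sets of size [u], each is
    the entry set of at most [l ^ l] tuples, and [u] takes [l.+1] values. *)
Lemma sum_tuple_distinct_le l (c : nat -> R) (K : R) :
  (forall u, (u <= l)%N -> 0 <= c u) ->
  (forall u, (u <= l)%N -> #|T|%:R ^+ u * c u <= K) ->
  \sum_(x : l.-tuple T) c #|[set y in x]| <= (l.+1)%:R * l%:R ^+ l * K.
Proof.
move=> c0 cK.
rewrite (partition_big (fun x : l.-tuple T => [set y in x]) (fun U => #|U| < l.+1)%N) /=; last first.
  by move=> x _; rewrite ltnS cardsE (leq_trans (card_size _)) // size_tuple.
apply: le_trans (_ : \sum_(U : {set T} | (#|U| < l.+1)%N) l%:R ^+ l * c #|U| <= _).
  apply: ler_sum => U Ul.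
  rewrite (eq_bigr (fun=> c #|U|)); last by move=> x /eqP ->.
  have cU : 0 <= c #|U| by apply: c0.
  apply: le_trans (_ : \sum_(x : l.-tuple T) (all (fun w => w \in U) x)%:R * c #|U| <= _).
    rewrite big_mkcond /=; apply: ler_sum => x _; case: eqP => [<-|_]; last by rewrite mulr_ge0.
    rewrite (_ : all _ _ = true) ?mul1r //; by apply/allP => y; rewrite inE.
  rewrite -mulr_suml sum_tuple_in ler_wpM2r // lerXn2r ?nnegrE ?ler0n // ler_nat.
  by rewrite -ltnS.
rewrite (partition_big (fun U : {set T} => inord #|U| : 'I_l.+1) xpredT) //=.
apply: le_trans (_ : \sum_(u < l.+1) l%:R ^+ l * K <= _).
  apply: ler_sum => u _.
  rewrite (eq_bigl (fun U : {set T} => U \in [set U : {set T} | #|U| == u])); last first.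
    move=> U; rewrite inE; apply/andP/eqP => [[Ul /eqP <-]|Uu]; first by rewrite inordK.
    by rewrite Uu ltn_ord; split=> //; rewrite inord_val.
  rewrite (eq_bigr (fun=> l%:R ^+ l * c u)); last by move=> U; rewrite inE => /eqP ->.
  rewrite sumr_const card_draws -[X in X <= _]mulr_natl mulrCA ler_wpM2l ?exprn_ge0 ?ler0n //.
  have ul : (u <= l)%N by rewrite -ltnS.
  apply: le_trans (cK u ul); rewrite ler_wpM2r ?c0 // -natrX ler_nat bin_le_exp //.
by rewrite sumr_const card_ord -[X in X <= _]mulr_natl mulrA.
Qed.
End TupleSums.

(** * Expectation over the random graph *)

Section Expectation.
Variables (R : realType) (n : nat) (p : R).
Hypotheses (p0 : 0 <= p) (p1 : p <= 1).
Local Notation graph := {set {set 'I_n}}.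

Definition Ex (F : graph -> R) : R := \sum_(E : graph | is_graph E) ER_weight p E * F E.

Lemma ER_weight_ge0 (E : graph) : 0 <= ER_weight p E.
Proof. by rewrite mulr_ge0 // exprn_ge0 // subr_ge0. Qed.

Lemma Ex_sum (I : finType) (F : I -> graph -> R) (P : pred I) :
  Ex (fun E => \sum_(i | P i) F i E) = \sum_(i | P i) Ex (F i).
Proof.
by rewrite exchange_big; apply: eq_bigr => E _; rewrite mulr_sumr.
Qed.

Lemma ExD F G : Ex (fun E => F E + G E) = Ex F + Ex G.
Proof. by rewrite -big_split; apply: eq_bigr => E _; rewrite mulrDr. Qed.

Lemma ExZ c F : Ex (fun E => c * F E) = c * Ex F.
Proof. by rewrite mulr_sumr; apply: eq_bigr => E _; rewrite mulrCA. Qed.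

Lemma eq_Ex F G : F =1 G -> Ex F = Ex G.
Proof. by move=> FG; apply: eq_bigr => E _; rewrite FG. Qed.

Lemma ER_prob_le (P : graph -> Prop) F :
  (forall E, 0 <= F E) -> (forall E, P E -> 1 <= F E) -> ER_prob p P <= Ex F.
Proof.
move=> F0 F1; rewrite /ER_prob /Ex big_mkcondr /=; apply: ler_sum => E _.
case: asboolP => [/F1 H|_]; last by rewrite mulr_ge0 ?ER_weight_ge0.
by rewrite ler_peMr ?ER_weight_ge0.
Qed.

(** Independence of the edges: expanding the product over all pairs recovers the sum over graphs
    with the weights [ER_weight]. *)
Lemma Ex_prod (g : {set 'I_n} -> bool -> R) :
  Ex (fun E => \prod_(e in all_pairs n) g e (e \in E)) =
  \prod_(e in all_pairs n) (p * g e true + (1 - p) * g e false).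
Proof.
pose F e := if e \in all_pairs n then p * g e true else 0.
pose G e := if e \in all_pairs n then (1 - p) * g e false else 1.
transitivity (\prod_e (F e + G e)); last first.
  rewrite [RHS]big_mkcond; apply: eq_bigr => e _; rewrite /F /G.
  by case: ifP => _ //; rewrite add0r.
rewrite (bigA_distr 1 _ F G) /= /Ex big_mkcond /=; apply: eq_bigr => E _.
case: ifP => [gE|/negbT].
  rewrite /ER_weight.
  have -> : p ^+ #|E| * (1 - p) ^+ ('C(n, 2) - #|E|) =
      \prod_(e in all_pairs n) if e \in E then p else 1 - p.
    have cAP : #|all_pairs n| = 'C(n, 2) by rewrite card_draws card_ord.
    rewrite (bigID (mem E)) /=; congr (_ * _).
      rewrite (eq_bigr (fun=> p)); last by move=> e /andP[_ ->].
      rewrite prodr_const; congr (_ ^+ _); apply: eq_card => e.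
      by rewrite -[RHS]topredE /=; case: (boolP (e \in E)) => [/(subsetP gE) ->|]; rewrite ?andbF.
    rewrite (eq_bigr (fun=> 1 - p)); last by move=> e /andP[_ /negPf ->].
    rewrite prodr_const; congr (_ ^+ _).
    rewrite -cAP -(cardsID E (all_pairs n)) (setIidPr gE) addKn; apply: eq_card => e.
    by rewrite !inE -[RHS]topredE /= !inE andbC.
  rewrite -big_split /= big_mkcond /=; apply: eq_bigr => e _; rewrite /F /G.
  case: ifP => eAP; last by case: ifP => // /(subsetP gE); rewrite eAP.
  by case: (e \in E).
case/subsetPn => e eE eAP; rewrite (bigD1 e) //= eE /F (negPf eAP) mul0r.
by [].
Qed.

Lemma centered_moment_le c : (1 < c)%N -> `|p * (1 - p) ^+ c + (1 - p) * (- p) ^+ c| <= p.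
Proof.
have q0 : 0 <= 1 - p by rewrite subr_ge0.
have q1 : 1 - p <= 1 by rewrite gerBl.
move=> c1.
have h1 : (1 - p) ^+ c <= 1 - p.
  by case: c c1 => // c _; rewrite exprS ler_piMr // exprn_ile1.
have h2 : p ^+ c <= p * p.
  by case: c c1 {h1} => [|[|c]] // _; rewrite exprS exprS mulrA ler_piMr ?mulr_ge0 // exprn_ile1.
apply: le_trans (ler_normD _ _) _.
rewrite (normrM p) (normrM (1 - p)) !normrX normrN !(ger0_norm p0) !(ger0_norm q0).
have := ler_wpM2l p0 h1; have := ler_wpM2l q0 h2.
have : 0 <= p * p * p by rewrite !mulr_ge0.
lra.
Qed.

(** A centred edge that occurs exactly once has mean zero and kills the whole expectation. Otherwise
    each distinct edge of [es] contributes at most [p] by [centered_moment_le], and each edge of [H]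
    exactly [p]. *)
Lemma Ex_monomial (es : seq {set 'I_n}) (H : {set {set 'I_n}}) :
  {subset es <= all_pairs n} -> H \subset all_pairs n -> {in es, forall e, e \notin H} ->
  `|Ex (fun E => (\prod_(e <- es) ((e \in E)%:R - p)) * (H \subset E)%:R)| <=
  if all (fun e => count_mem e es != 1)%N es then p ^+ (size (undup es) + #|H|) else 0.
Proof.
move=> esP /subsetP HP esH.
pose g e (b : bool) : R := (b%:R - p) ^+ count_mem e es * (if e \in H then b%:R else 1).
have -> : Ex (fun E => (\prod_(e <- es) ((e \in E)%:R - p)) * (H \subset E)%:R) =
          Ex (fun E => \prod_(e in all_pairs n) g e (e \in E)).
  apply: eq_Ex => E; rewrite /g big_split /=; congr (_ * _).
    rewrite -prodr_undup_exp_count big_uniq ?undup_uniq // big_mkcond [RHS]big_mkcond /=.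
    apply: eq_bigr => e _; rewrite mem_undup; case: (boolP (e \in es)) => [/esP -> //|ne].
    by case: ifP => // _; rewrite (count_memPn ne) expr0.
  case: (boolP (H \subset E)) => [/subsetP HE|/subsetPn[e eH eE]].
    by rewrite big1 // => e _; case: ifP => // /HE ->.
  by rewrite (bigD1 e) ?HP //= eH (negPf eE) mul0r.
rewrite Ex_prod normr_prod.
have gH e : e \in H -> p * g e true + (1 - p) * g e false = p.
  move=> eH; have ne : e \notin es by apply/negP => /esH; rewrite eH.
  by rewrite /g (count_memPn ne) eH !expr0 !mul1r mulr1 mulr0 addr0.
have gN e : e \notin H -> p * g e true + (1 - p) * g e false =
    p * (1 - p) ^+ count_mem e es + (1 - p) * (- p) ^+ count_mem e es.
  by move=> /negPf eH; rewrite /g eH !mulr1 sub0r.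
case: ifP => [/allP cnt|/negbT]; last first.
  rewrite -has_predC => /hasP[e ees] /=; rewrite negbK => /eqP c1.
  rewrite (bigD1 e) ?esP //= gN ?esH // c1 !expr1.
  have -> : p * (1 - p) + (1 - p) * - p = 0 by ring.
  by rewrite normr0 mul0r.
apply: le_trans (_ : \prod_(e in all_pairs n) (if (e \in es) || (e \in H) then p else 1) <= _).
  apply: ler_prod => e _; rewrite normr_ge0 /=.
  case: (boolP (e \in H)) => eH; first by rewrite orbT gH // ger0_norm.
  rewrite orbF gN //; case: ifP => ees.
    apply: centered_moment_le; have := cnt e ees; have : (0 < count_mem e es)%N by rewrite -has_count has_pred1.
    by case: (count_mem e es) => [|[]].
  by rewrite (count_memPn (negbT ees)) !expr0 !mulr1 addrC subrK normr1.
rewrite -big_mkcondr /= prodr_const.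
rewrite (_ : #|_| = size (undup es) + #|H|)%N //.
have -> : size (undup es) = #|[set e in es]|.
  by rewrite cardsE -(card_uniqP (undup_uniq es)); apply: eq_card => e; rewrite mem_undup.
rewrite -cardsUI.
rewrite (_ : _ :&: H = set0) ?cards0 ?addn0; last first.
  by apply/setP => e; rewrite !inE; apply/andP => -[/esH /negP].
apply: eq_card => e; rewrite !inE -[LHS]topredE /=.
by case: (boolP (e \in es)) => [/esP ->|_] //=; case: (boolP (e \in H)) => [/HP ->|]; rewrite ?andbF.
Qed.
End Expectation.

(** * Counting distinct edges in tuples and walks *)

Lemma card_set_seq (T : finType) (x : seq T) : #|[set y in x]| = size (undup x).
Proof.
by rewrite cardsE -(card_uniqP (undup_uniq x)); apply: eq_card => e; rewrite mem_undup.
Qed.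

Lemma size_undup_repeated (T : eqType) (x : seq T) :
  all (fun e => count_mem e x != 1)%N x -> (2 * size (undup x) <= size x)%N.
Proof.
move=> /allP H; rewrite -[in X in (_ <= X)%N](perm_size (perm_count_undup x)).
rewrite size_flatten /shape -map_comp sumnE big_map mulnC.
rewrite -sum1_size big_distrl /=.
rewrite big_seq [X in (_ <= X)%N]big_seq; apply: leq_sum => e; rewrite mem_undup => ex /=.
rewrite size_nseq; have := H e ex; have : (0 < count_mem e x)%N by rewrite -has_count has_pred1.
by case: (count_mem e x) => [|[]].
Qed.

Definition walk_edges (T : finType) (i : T) (y : seq T) := pairmap (fun a b => [set a; b]) i y.

Lemma mem_walk_edges (T : finType) (i : T) (y : seq T) e : e \in walk_edges i y ->
  exists a b, [/\ a \in i :: y, b \in i :: y & e = [set a; b]].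
Proof.
elim: y i => // j y IH i; rewrite /walk_edges /= inE => /orP[/eqP ->|/IH[a [b [ay b_y ->]]]].
  by exists i, j; rewrite !inE !eqxx orbT.
by exists a, b; split; rewrite // inE ?ay ?b_y orbT.
Qed.

Lemma walk_edges_pairs n (i : 'I_n) (y : seq 'I_n) :
  path (fun a b => a != b) i y -> {subset walk_edges i y <= all_pairs n}.
Proof.
elim: y i => // j y IH i /= /andP[ij py] e; rewrite /walk_edges /= inE => /orP[/eqP ->|].
  by rewrite inE cards2 ij.
exact: IH.
Qed.

Lemma size_walk_edges (T : finType) (i : T) y : size (walk_edges i y) = size y.
Proof. exact: size_pairmap. Qed.

(* Each vertex visited for the first time comes with a new edge. *)
Lemma walk_vertices_le (T : finType) (i : T) (y : seq T) :
  (size (undup (i :: y)) <= (size (undup (walk_edges i y))).+1)%N.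
Proof.
elim: y i => // j y IH i; rewrite /walk_edges [pairmap _ _ _]/= -/(walk_edges j y).
rewrite [undup (i :: _)]/=; case: ifP => iy.
  apply: leq_trans (IH j) _; rewrite ltnS /=; case: ifP => //= _; exact: leqnSn.
rewrite [size (i :: _)]/= ltnS; apply: leq_trans (IH j) _.
rewrite [undup (_ :: walk_edges _ _)]/=; case: ifP => // /mem_walk_edges[a [b [ay b_y e]]].
have : i \in [set a; b] by rewrite -e !inE eqxx.
by rewrite !inE => /orP[] /eqP iE; move: iy; rewrite iE ?ay ?b_y.
Qed.

Section CommonEdges.
Variable n : nat.
Implicit Types (U s : {set 'I_n}) (E : {set {set 'I_n}}).

(** The edges whose presence says that all of [U] consists of common neighbours of [s]; they play
    the part of [H] in [Ex_monomial]. *)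
Definition nb_edges U s : {set {set 'I_n}} := [set [set wz.1; wz.2] | wz in setX U s].

Lemma mem_nb_edges U s e : e \in nb_edges U s ->
  exists w z, [/\ w \in U, z \in s & e = [set w; z]].
Proof. by case/imsetP => -[w z]; rewrite !inE /= => /andP[wU zs] ->; exists w, z. Qed.

Lemma card_nb_edges U s : (forall w, w \in U -> w \notin s) ->
  #|nb_edges U s| = (#|U| * #|s|)%N.
Proof.
move=> dj; rewrite -cardsX card_in_imset // => -[w z] [w' z']; rewrite !inE /=.
move=> /andP[wU zs] /andP[wU' zs'] e.
have ww : w = w'.
  have : w \in [set w'; z'] by rewrite -e !inE eqxx.
  by rewrite !inE => /orP[/eqP //|/eqP wz]; move: (dj _ wU); rewrite wz zs'.
have zz : z = z'.
  have : z \in [set w'; z'] by rewrite -e !inE eqxx orbT.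
  by rewrite !inE => /orP[/eqP wz|/eqP //]; move: (dj _ wU'); rewrite -wz zs.
by rewrite ww zz.
Qed.

Lemma nb_edges_pairs U s : (forall w, w \in U -> w \notin s) ->
  nb_edges U s \subset all_pairs n.
Proof.
move=> dj; apply/subsetP => e /mem_nb_edges[w [z [wU zs ->]]]; rewrite inE cards2.
by rewrite (_ : w != z) //; apply: contraNneq (dj _ wU) => ->.
Qed.

Lemma all_nb E s (x : seq 'I_n) : (forall w, w \in x -> w \notin s) ->
  all (fun w => w \in nb E s) x = (nb_edges [set w in x] s \subset E).
Proof.
move=> dj; apply/allP/subsetP.
  move=> H e /mem_nb_edges[w [z []]]; rewrite inE => wx zs ->.
  by have /nbP/(_ z zs) := H w wx; rewrite /adj => /andP[].
move=> H w wx; apply/nbP => z zs; rewrite /adj H ?andbT.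
  by apply: contraNneq (dj _ wx) => ->.
by apply/imsetP; exists (w, z); rewrite // !inE wx.
Qed.
End CommonEdges.

(** The weight of a closed walk whose base point is listed at both ends. Summed over tuples of
    length [l.+1] it gives the trace of the [l]-th power of [M]. *)
Definition walk_weight (R : realFieldType) n (M : 'I_n -> 'I_n -> R) (x : seq 'I_n) : R :=
  if x is i :: y then (last i y == i)%:R * \prod_(m <- pairmap M i y) m else 0.

Definition moment_cst (R : realType) (l : nat) : R := (l.+1)%:R * l%:R ^+ l.

(** * High moments of centred degrees and of traces *)

Section Moments.
Variables (R : realType) (n : nat) (p : R).
Hypotheses (p0 : 0 <= p) (p1 : p <= 1).
Implicit Types (E : {set {set 'I_n}}) (s : {set 'I_n}).

Definition star E s v : R :=
  \sum_w (if (w \in nb E s) && (w != v) then ([set v; w] \in E)%:R - p else 0).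

(** In the expanded power, a tuple with [u] distinct entries involves [u] edges to [v] and
    [u * #|s|] edges to [s], and contributes only if every edge to [v] repeats, which forces
    [u <= r]. The total for each such [u] is of order [(n p^(|s|+1))^u], at most [Q ^+ r]. *)
Lemma star_moment s v r (Q : R) : v \notin s -> 1 <= Q -> n%:R * p ^+ #|s|.+1 <= Q ->
  Ex p (fun E => star E s v ^+ (2 * r)) <= moment_cst R (2 * r) * Q ^+ r.
Proof.
move=> vs Q1 nQ.
pose c u : R := if (u <= r)%N then p ^+ (#|s|.+1 * u) else 0.
under eq_Ex => E do rewrite expr_sum_tuple.
rewrite Ex_sum.
apply: le_trans (_ : \sum_(x : (2 * r).-tuple 'I_n) c #|[set y in x]| <= _); last first.
  apply: sum_tuple_distinct_le => u ul; rewrite /c; case: ifP => ur; rewrite ?exprn_ge0 //.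
    rewrite card_ord exprM -exprMn.
    apply: le_trans (_ : Q ^+ u <= _); last by rewrite ler_weXn2l.
    by rewrite lerXn2r ?nnegrE ?mulr_ge0 ?ler0n ?exprn_ge0 // (le_trans _ Q1).
  by rewrite mulr0 exprn_ge0 // (le_trans _ Q1).
apply: ler_sum => x _; apply: le_trans (ler_norm _) _.
case: (boolP (all (fun w => (w \notin s) && (w != v)) x)) => [/allP ok|]; last first.
  case/allPn => w wx bad; rewrite /Ex big1 ?normr0; first by rewrite /c; case: ifP; rewrite ?exprn_ge0.
  move=> E _; rewrite (_ : \prod_(_ <- _) _ = 0) ?mulr0 //; apply/eqP.
  rewrite prodf_seq_eq0; apply/hasP; exists w => //=; case: ifP => // /andP[/nb_notin ws wv].
  by rewrite ws wv in bad.
pose es := [seq [set v; w] | w <- x].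
have dj w : w \in [set y in x] -> w \notin s by rewrite inE => /ok /andP[].
have -> : Ex p (fun E => \prod_(w <- x)
    (if (w \in nb E s) && (w != v) then ([set v; w] \in E)%:R - p else 0)) =
  Ex p (fun E => (\prod_(e <- es) ((e \in E)%:R - p)) * (nb_edges [set y in x] s \subset E)%:R).
  apply: eq_Ex => E; rewrite -all_nb; last by move=> w wx; apply: dj; rewrite inE.
  rewrite -prod_natb big_map -big_split /= big_seq [RHS]big_seq; apply: eq_bigr => w /ok /andP[_ ->].
  by rewrite andbT; case: ifP; rewrite ?mulr1 ?mulr0.
apply: le_trans (Ex_monomial p0 p1 _ _ _) _.
- by move=> e /mapP[w /ok /andP[_ wv] ->]; rewrite inE cards2 (eq_sym v) wv.
- exact: nb_edges_pairs.
- move=> e /mapP[w /ok /andP[ws wv] ->]; apply/negP => /mem_nb_edges[w' [z []]].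
  rewrite inE => /ok /andP[w's w'v] zs e1.
  have : v \in [set w'; z] by rewrite -e1 !inE eqxx.
  by rewrite !inE => /orP[/eqP vw|/eqP vz]; [rewrite vw eqxx in w'v|rewrite vz zs in vs].
have inj : injective (fun w => [set v; w]).
  move=> w w' e1; have : w \in [set v; w'] by rewrite -e1 !inE eqxx orbT.
  rewrite !inE => /orP[/eqP wv|/eqP //].
  have : w' \in [set v; w] by rewrite e1 !inE eqxx orbT.
  by rewrite !inE wv orbb => /eqP ->.
rewrite card_nb_edges // card_set_seq (undup_map_inj inj) size_map.
case: ifP => [/size_undup_repeated|_]; last by rewrite /c; case: ifP; rewrite ?exprn_ge0.
rewrite (undup_map_inj inj) !size_map size_tuple leq_pmul2l // /c => ->.
by rewrite -mulnS (mulnC (size _)).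
Qed.

Definition cmx E s (i j : 'I_n) : R :=
  if [&& i \in nb E s, j \in nb E s & i != j] then ([set i; j] \in E)%:R - p else 0.

Lemma prod_cmx E s i y : (i \in nb E s)%:R * \prod_(m <- pairmap (cmx E s) i y) m =
  (path (fun a b => a != b) i y && all (fun w => w \in nb E s) (i :: y))%:R *
  \prod_(e <- walk_edges i y) ((e \in E)%:R - p).
Proof.
elim: y i => [|j y IH] i; first by rewrite !big_nil /= andbT.
rewrite /walk_edges /= !big_cons {1}/cmx -/(walk_edges j y).
have := IH j; rewrite /=.
case: (i \in nb E s); last by rewrite mul0r andbF mul0r.
case: (j \in nb E s); last by rewrite !andbF /= !(mul0r, mulr0).
by case: (i != j) => /=; rewrite !mul1r ?mul0r // => ->; rewrite mulrCA.
Qed.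

(** The same count for closed walks: repetition leaves at most [r] distinct walk edges, so at most
    [r.+1] vertices by [walk_vertices_le]. A single factor [n] remains unpaid because [u] vertices
    guarantee only [u.-1] walk edges. *)
Lemma walk_moment s r (Q : R) : (0 < r)%N -> 1 <= Q -> n%:R * p ^+ #|s|.+1 <= Q ->
  Ex p (fun E => \sum_(x : (2 * r).+1.-tuple 'I_n) walk_weight (cmx E s) x) <=
  moment_cst R (2 * r).+1 * (n%:R * Q ^+ r).
Proof.
move=> r0 Q1 nQ.
pose c u : R := if (0 < u <= r.+1)%N then p ^+ (#|s| * u + u.-1) else 0.
have c0 u : 0 <= c u by rewrite /c; case: ifP; rewrite ?exprn_ge0.
have Q0 : 0 <= Q by apply: le_trans Q1.
rewrite Ex_sum.
apply: le_trans (_ : \sum_(x : (2 * r).+1.-tuple 'I_n) c #|[set y in x]| <= _); last first.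
  apply: sum_tuple_distinct_le => // u ul; rewrite /c; case: ifP; last first.
    by rewrite mulr0 mulr_ge0 ?exprn_ge0.
  case: u {ul} => // u; rewrite ltnS /= => ur.
  have -> : (#|s| * u.+1 + u = #|s| + #|s|.+1 * u)%N by rewrite mulnS mulSn; lia.
  rewrite card_ord exprD exprS mulrACA exprM -exprMn.
  apply: ler_pM; rewrite ?mulr_ge0 ?exprn_ge0 ?mulr_ge0 ?exprn_ge0 //.
    by rewrite ler_piMr // exprn_ile1.
  apply: le_trans (_ : Q ^+ u <= _); last by rewrite ler_weXn2l.
  by rewrite lerXn2r ?nnegrE ?mulr_ge0 ?ler0n ?exprn_ge0.
apply: ler_sum => x _; apply: le_trans (ler_norm _) _.
rewrite card_set_seq; case: x => -[//|i y] sz; rewrite /tval.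
have sy : size y = (2 * r)%N by case/eqP: (sz).
clear sz; rewrite /walk_weight.
(* As [r] is positive the walk has a first step, whose matrix entry already vanishes unless [i] lies
   in [nb E s]; this supplies the indicator needed by [prod_cmx]. *)
have dropi E : \prod_(m <- pairmap (cmx E s) i y) m =
    (i \in nb E s)%:R * \prod_(m <- pairmap (cmx E s) i y) m.
  case: (y) sy => [e|j y' _]; first by move: r0 e; case: (r).
  by rewrite /= big_cons /cmx; case: (i \in nb E s); rewrite /= ?mul1r ?mul0r.
under eq_Ex => E do rewrite dropi prod_cmx.
case: (boolP (path (fun a b => a != b) i y && all (fun w => w \notin s) (i :: y))) => [|bad]; last first.
  rewrite /Ex big1 ?normr0 // => E _.
  rewrite (_ : (_ && _) = false) ?mul0r ?mulr0 //; apply: contraNF bad => /andP[-> /allP H].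
  by rewrite andTb; apply/allP => w /H; apply: nb_notin.
case/andP => py /allP ok.
have dj w : w \in [set v in i :: y] -> w \notin s by rewrite inE => /ok.
have -> : Ex p (fun E => (last i y == i)%:R *
    ((path (fun a b => a != b) i y && all (fun w => w \in nb E s) (i :: y))%:R *
     \prod_(e <- walk_edges i y) ((e \in E)%:R - p))) =
  (last i y == i)%:R * Ex p (fun E => (\prod_(e <- walk_edges i y) ((e \in E)%:R - p)) *
     (nb_edges [set v in i :: y] s \subset E)%:R).
  rewrite -ExZ; apply: eq_Ex => E; rewrite py andTb all_nb //; congr (_ * _); exact: mulrC.
rewrite normrM; apply: le_trans (_ : `|Ex p (fun E => (\prod_(e <- walk_edges i y) ((e \in E)%:R - p)) *
     (nb_edges [set v in i :: y] s \subset E)%:R)| <= _).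
  by rewrite ler_piMl // ger0_norm // lern1 leq_b1.
apply: le_trans (Ex_monomial p0 p1 (walk_edges_pairs py) (nb_edges_pairs dj) _) _.
  move=> e /mem_walk_edges[a [b [ai bi ->]]]; apply/negP => /mem_nb_edges[w [z [_ zs e1]]].
  have : z \in [set a; b] by rewrite e1 !inE eqxx orbT.
  by rewrite !inE => /orP[] /eqP zE; [have := ok _ ai|have := ok _ bi]; rewrite -zE zs.
case: ifP => [/size_undup_repeated|_]; last exact: c0.
rewrite size_walk_edges sy leq_pmul2l // => er.
have ve := walk_vertices_le i y.
rewrite card_nb_edges // /c card_set_seq.
have u0 : (0 < size (undup (i :: y)))%N by rewrite -card_set_seq card_gt0; apply/set0Pn; exists i; rewrite !inE eqxx.
rewrite u0 (leq_trans ve) ?ltnS //=.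
rewrite ler_wiXn2l //; move: ve u0; set u := size (undup (i :: y)); set m := size _; lia.
Qed.
End Moments.

(** * Bounding a quadratic form by the trace of a high power *)

Section SpectralNorm.
Variable R : realFieldType.

Lemma exp_mx_walks n (M : 'M[R]_n.+1) l i k :
  (M ^+ l) i k = \sum_(y : l.-tuple 'I_n.+1) (last i y == k)%:R * \prod_(m <- pairmap (fun a b => M a b) i y) m.
Proof.
elim: l i => [|l IH] i.
  rewrite (sum_tuple0 (fun y => (last i y == k)%:R * \prod_(m <- pairmap _ i y) m)).
  by rewrite big_nil mulr1 expr0 mxE /=.
rewrite exprS mxE (sum_tupleS l (fun y => (last i y == k)%:R * \prod_(m <- pairmap _ i y) m)).
apply: eq_bigr => j _; rewrite IH mulr_sumr; apply: eq_bigr => y _ /=.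
by rewrite big_cons mulrCA.
Qed.

Definition mxform n (M : 'M[R]_n) (f : 'cV[R]_n) : R := (f^T *m M *m f) 0 0.

Lemma cauchy_schwarz (I : finType) (f g : I -> R) :
  (\sum_i f i * g i) ^+ 2 <= (\sum_i f i ^+ 2) * (\sum_i g i ^+ 2).
Proof.
have : 0 <= \sum_i \sum_j (f i * g j - f j * g i) ^+ 2.
  by apply: sumr_ge0 => i _; apply: sumr_ge0 => j _; apply: sqr_ge0.
have -> : \sum_i \sum_j (f i * g j - f j * g i) ^+ 2 =
   2 * ((\sum_i f i ^+ 2) * (\sum_i g i ^+ 2)) - 2 * (\sum_i f i * g i) ^+ 2.
  transitivity (\sum_i \sum_j (f i ^+ 2 * g j ^+ 2 + g i ^+ 2 * f j ^+ 2 -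
      2 * ((f i * g i) * (f j * g j)))).
    by apply: eq_bigr => i _; apply: eq_bigr => j _; ring.
  under eq_bigr => i _ do rewrite sumrB big_split /= -!mulr_sumr.
  rewrite sumrB big_split /= -!mulr_suml -mulr_sumr -mulr_suml; ring.
lra.
Qed.

Lemma trmx_exp n (M : 'M[R]_n.+1) k : M^T = M -> (M ^+ k)^T = M ^+ k.
Proof.
move=> Ms; elim: k => [|k IH]; first by rewrite expr0 trmx1.
by rewrite [in LHS]exprS -mulmxE trmx_mul IH Ms mulmxE -exprSr.
Qed.

Lemma mxform_sqr n (M : 'M[R]_n.+1) k f : M^T = M ->
  mxform (M ^+ k) f ^+ 2 <= mxform 1 f * mxform (M ^+ (k + k)) f.
Proof.
move=> Ms.
have Mk := trmx_exp k Ms.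
have -> : mxform 1 f = \sum_i f i 0 ^+ 2.
  by rewrite /mxform mulmx1 mxE; apply: eq_bigr => i _; rewrite mxE expr2.
have -> : mxform (M ^+ (k + k)) f = \sum_i ((M ^+ k *m f) i 0) ^+ 2.
  rewrite /mxform exprD -mulmxE mulmxA -mulmxA -{1}Mk -trmx_mul mxE.
  by apply: eq_bigr => i _; rewrite mxE expr2.
have -> : mxform (M ^+ k) f = \sum_i f i 0 * (M ^+ k *m f) i 0.
  by rewrite /mxform -mulmxA mxE; apply: eq_bigr => i _; rewrite mxE.
exact: cauchy_schwarz.
Qed.

(** For symmetric [M] the trace of [M ^+ (k + k)] is the squared Frobenius norm of [M ^+ k], which
    dominates its operator norm. *)
Lemma mxform_trace n (M : 'M[R]_n.+1) k f : M^T = M ->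
  0 <= \tr (M ^+ (k + k)) /\ mxform (M ^+ (k + k)) f <= \tr (M ^+ (k + k)) * mxform 1 f.
Proof.
move=> Ms.
have Mk := trmx_exp k Ms.
have trE : \tr (M ^+ (k + k)) = \sum_i \sum_j ((M ^+ k) i j) ^+ 2.
  rewrite exprD; apply: eq_bigr => i _; rewrite mxE; apply: eq_bigr => j _.
  by rewrite -{2}Mk mxE expr2.
split; first by rewrite trE; apply: sumr_ge0 => i _; apply: sumr_ge0 => j _; apply: sqr_ge0.
have -> : mxform (M ^+ (k + k)) f = \sum_i ((M ^+ k *m f) i 0) ^+ 2.
  rewrite /mxform exprD -mulmxE mulmxA -mulmxA -{1}Mk -trmx_mul mxE.
  by apply: eq_bigr => i _; rewrite mxE expr2.
have -> : mxform 1 f = \sum_i f i 0 ^+ 2.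
  by rewrite /mxform mulmx1 mxE; apply: eq_bigr => i _; rewrite mxE expr2.
rewrite trE mulr_suml; apply: ler_sum => i _; rewrite mxE.
exact: cauchy_schwarz.
Qed.

Lemma mxform1_ge0 n (f : 'cV[R]_n) : 0 <= mxform 1%:M f.
Proof. by rewrite /mxform mulmx1 mxE sumr_ge0 // => i _; rewrite mxE -expr2 sqr_ge0. Qed.

(* Repeated Cauchy-Schwarz. *)
Lemma mxform_pow n (M : 'M[R]_n.+1) j f : M^T = M ->
  mxform M f ^+ (2 ^ j.+1) <= mxform (M ^+ (2 ^ j.+1)) f * mxform 1 f ^+ (2 ^ j.+1).-1.
Proof.
move=> Ms; have m0 : 0 <= mxform 1 f := mxform1_ge0 f.
suff sq i : (mxform M f ^+ (2 ^ i)) ^+ 2 <=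
    mxform (M ^+ (2 ^ i.+1)) f * mxform 1 f ^+ (2 ^ i.+1).-1.
  by rewrite {1}expnSr exprM.
have red i' : (mxform M f ^+ (2 ^ i')) ^+ 2 <=
    (mxform (M ^+ (2 ^ i')) f * mxform 1 f ^+ (2 ^ i').-1) ^+ 2 ->
    (mxform M f ^+ (2 ^ i')) ^+ 2 <= mxform (M ^+ (2 ^ i'.+1)) f * mxform 1 f ^+ (2 ^ i'.+1).-1.
  move=> H; apply: le_trans H _; rewrite exprMn.
  apply: le_trans (ler_wpM2r _ (mxform_sqr (2 ^ i') f Ms)) _; first by rewrite exprn_ge0 ?exprn_ge0.
  have -> : (2 ^ i'.+1).-1 = ((2 ^ i').-1 * 2).+1.
    by have : (0 < 2 ^ i')%N by [rewrite expn_gt0]; rewrite expnS; lia.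
  by rewrite (exprS _ ((2 ^ i').-1 * 2)) exprM expnS mul2n -addnn [X in _ <= X]mulrCA mulrA.
elim: i => [|i IH]; first by apply: red; rewrite expn0 !expr1 mulr1.
apply: red; rewrite -exprM -expnSr expnSr exprM in IH *.
rewrite lerXn2r ?nnegrE ?(le_trans _ IH) ?sqr_ge0 //.
Qed.

(** The trace method without eigenvalues: the form is raised to a power of two by repeated
    Cauchy-Schwarz and then compared with the trace, which is a sum over closed walks. *)
Lemma form_le_walks n (M : 'I_n -> 'I_n -> R) j (f : 'I_n -> R) :
  (forall i k, M i k = M k i) ->
  let W := \sum_(x : (2 ^ j.+1).+1.-tuple 'I_n) walk_weight M x in
  0 <= W /\
  (\sum_i \sum_k M i k * f i * f k) ^+ (2 ^ j.+1) <= W * (\sum_i f i ^+ 2) ^+ (2 ^ j.+1).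
Proof.
case: n M f => [|n] M f Ms W.
  have -> : W = 0 by rewrite /W big1 // => -[[|i y] //= _] _; case: i.
  by rewrite big_ord0 expr0n expn_eq0 /= mul0r.
pose MM : 'M[R]_n.+1 := \matrix_(i, k) M i k.
pose fv : 'cV[R]_n.+1 := \col_i f i.
have MT : MM^T = MM by apply/matrixP => i k; rewrite !mxE.
have fE : mxform MM fv = \sum_i \sum_k M i k * f i * f k.
  rewrite /mxform -mulmxA mxE; apply: eq_bigr => i _; rewrite !mxE mulr_sumr.
  by apply: eq_bigr => k _; rewrite !mxE; ring.
have oE : mxform 1 fv = \sum_i f i ^+ 2.
  by rewrite /mxform mulmx1 mxE; apply: eq_bigr => i _; rewrite !mxE expr2.
have WE : W = \tr (MM ^+ (2 ^ j.+1)).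
  rewrite /W (sum_tupleS _ (walk_weight M)); apply: eq_bigr => i _.
  rewrite exp_mx_walks; apply: eq_bigr => y _ /=; congr (_ * _).
  by congr (\prod_(m <- _) m); elim: (tval y) i => //= k z IH i; rewrite mxE IH.
have E2 : (2 ^ j.+1 = 2 ^ j + 2 ^ j)%N by rewrite expnS mul2n addnn.
have := mxform_trace (2 ^ j) fv MT; rewrite -E2 -WE => -[W0 H]; split=> //.
rewrite -fE -oE; apply: le_trans (mxform_pow j fv MT) _.
apply: le_trans (ler_wpM2r _ H) _; first by rewrite exprn_ge0 // mxform1_ge0.
rewrite -mulrA -exprS prednK // expn_gt0 //.
Qed.
End SpectralNorm.

(** * Pseudorandomness with overwhelming probability *)

Section Good.
Variables (R : realType) (n : nat) (E : {set {set 'I_n}}) (p ga : R) (d : nat).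
Implicit Types s : {set 'I_n}.

Lemma card_natr (T : finType) (A : {set T}) : #|A|%:R = \sum_w (w \in A)%:R :> R.
Proof.
by rewrite -sum1_card natr_sum big_mkcond; apply: eq_bigr => w _; case: (w \in A).
Qed.

Lemma mem_nb_setU1 v s w : (w \in nb E (v |: s)) = (w \in nb E s) && adj E w v.
Proof.
apply/nbP/andP.
  by move=> H; split; [apply/nbP => z zs|]; apply: H; rewrite !inE ?zs ?eqxx ?orbT.
by case=> /nbP H wv z; rewrite !inE => /orP[/eqP ->|/H].
Qed.

Lemma starE s v : star p E s v = #|nb E (v |: s)|%:R - p * #|nb E s :\ v|%:R.
Proof.
rewrite !card_natr mulr_sumr -sumrB; apply: eq_bigr => w _.
rewrite mem_nb_setU1 in_setD1 /adj (setUC [set v]).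
case: (w \in nb E s); rewrite ?andbF /=; last by rewrite mulr0 subr0.
by case: (w != v) => /=; rewrite ?mulr1 ?mulr0 ?subr0.
Qed.

Hypotheses (p0 : 0 < p) (pga : p <= ga) (ga1 : 2 * d.+1%:R * ga <= 1).
Let q m : R := n%:R * p ^+ m.
Hypothesis qd : 1 <= ga * q d.
(** The exponent is capped at [d] because [n p^(d+1)] may be below 1; for sets of [d] vertices the
    error is measured on the scale [q d]. *)
Hypothesis Hstar : forall (s : {set 'I_n}) v, (#|s| <= d)%N -> v \notin s ->
  `|star p E s v| <= ga * q (minn #|s|.+1 d).
Hypothesis Hform : forall (s : {set 'I_n}) (f : 'I_n -> R), (#|s| < d)%N ->
  `|\sum_i \sum_k cmx p E s i k * f i * f k| <= ga * q #|s|.+1 * \sum_i f i ^+ 2.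

Let ga0 : 0 < ga. Proof. exact: lt_le_trans pga. Qed.
Let d1 : 1 <= d.+1%:R :> R. Proof. by rewrite ler1n. Qed.
Let ga_half : ga <= 2^-1.
Proof.
have : 2 * ga <= 2 * d.+1%:R * ga by rewrite ler_wpM2r ?(ltW ga0) //; move: (d.+1%:R : R) d1 => x x1; lra.
by move: ga1; lra.
Qed.
Let q_ge0 m : 0 <= q m. Proof. by rewrite mulr_ge0 ?ler0n ?exprn_ge0 // ltW. Qed.
Let qS m : q m.+1 = p * q m. Proof. by rewrite /q exprS mulrCA. Qed.
Let p1 : p <= 1. Proof. by move: pga ga_half; lra. Qed.
Let q_mono m m' : (m <= m')%N -> q m' <= q m.
Proof.
by move=> st; rewrite ler_wpM2l ?ler0n // ler_wiXn2l ?(ltW p0).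
Qed.

(** The sum [star] leaves out [v] itself. Restoring it costs at most [p], which [qd] absorbs into
    the second copy of [ga * q]. *)
Let nb_step s v : (#|s| <= d)%N -> v \notin s ->
  `|#|nb E (v |: s)|%:R - p * #|nb E s|%:R| <= 2 * ga * q (minn #|s|.+1 d).
Proof.
move=> sd vs; have := Hstar sd vs; rewrite starE.
have H : 1 <= ga * q (minn #|s|.+1 d).
  by apply: le_trans qd _; rewrite ler_wpM2l ?(ltW ga0) // q_mono // geq_minr.
have : #|nb E s|%:R = (v \in nb E s)%:R + #|nb E s :\ v|%:R :> R by rewrite -natrD -cardsD1.
set b : R := (v \in _)%:R => ->.
have b01 : 0 <= p * b /\ p * b <= 1.
  rewrite /b; case: (v \in _) => /=; rewrite ?mulr1 ?mulr0; by split=> //; rewrite ltW.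
case: b01 => b0 b1.
by rewrite !ler_norml => /andP[? ?]; apply/andP; split; lra.
Qed.

Let nb_conc m : (m <= d)%N -> forall s : {set 'I_n}, #|s| = m ->
  `|#|nb E s|%:R - q m| <= 2 * m%:R * ga * q m.
Proof.
elim: m => [_ s /eqP|m IH md s sm].
  rewrite cards_eq0 => /eqP ->.
  have -> : nb E set0 = setT by apply/setP => w; rewrite [RHS]inE; apply/nbP => z; rewrite inE.
  by rewrite cardsT card_ord /q expr0 mulr1 subrr normr0 !mulr0 !mul0r.
have [v vs] : exists v, v \in s by apply/set0Pn; rewrite -card_gt0 sm.
have sm' : #|s :\ v| = m by move: (cardsD1 v s); rewrite vs sm add1n => -[].
have vs' : v \notin s :\ v by rewrite !inE eqxx.
have := @nb_step (s :\ v) v; rewrite sm' setD1K // => /(_ (ltnW md) vs').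
rewrite (minn_idPl md) => H1.
have H2 := IH (ltnW md) _ sm'.
have H3 : `|p * #|nb E (s :\ v)|%:R - p * q m| <= 2 * m%:R * ga * q m.+1.
  rewrite -mulrBr normrM (gtr0_norm p0) qS mulrCA ler_wpM2l ?(ltW p0) //.
rewrite -qS in H3; move: (ler_normD (#|nb E s|%:R - p * #|nb E (s :\ v)|%:R) (p * #|nb E (s :\ v)|%:R - q m.+1)).
rewrite addrA subrK => H4; apply: le_trans H4 _.
rewrite -[m.+1%:R]natr1; lra.
Qed.

Lemma good_pseudorandom : pseudorandom E p (4 * d.+1%:R * ga) d.
Proof.
split.
- move=> s sd; apply: le_trans (nb_conc sd erefl) _; rewrite -/(q _).
  rewrite ler_wpM2r // ler_wpM2r ?(ltW ga0) //.
  have : #|s|%:R <= d.+1%:R :> R by rewrite ler_nat ltnW.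
  have : 0 <= #|s|%:R :> R by rewrite ler0n.
  move: (d.+1%:R : R) (#|s|%:R : R) => x y; lra.
- move=> s sd; have [v vs] : exists v, v \in s by apply/set0Pn; rewrite -card_gt0 sd.
  have sm' : #|s :\ v| = d by move: (cardsD1 v s); rewrite vs sd add1n => -[].
  have vs' : v \notin s :\ v by rewrite !inE eqxx.
  (* The 4 in the error comes from here: [2 * ga * q d] from this step, and as much again because
     [p <= ga] multiplies a set of size at most [2 * q d]. *)
  have := @nb_step (s :\ v) v; rewrite sm' setD1K // => /(_ (leqnn _) vs').
  rewrite (minn_idPr (leqnSn d)) ler_norml => /andP[_ H1].
  have := nb_conc (leqnn d) sm'; rewrite ler_norml => /andP[_ H2].
  have H3 : 2 * d%:R * ga * q d <= 1 * q d.
    rewrite ler_wpM2r //; apply: le_trans ga1; rewrite ler_wpM2r ?(ltW ga0) //.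
    by rewrite ler_wpM2l // ler_nat.
  have H4 : p * #|nb E (s :\ v)|%:R <= ga * (2 * q d).
    apply: ler_pM; rewrite ?ler0n ?(ltW p0) //; lra.
  have H5 : 4 * ga * q d <= 4 * d.+1%:R * ga * q d.
    by rewrite ler_wpM2r // ler_wpM2r ?(ltW ga0) //; move: (d.+1%:R : R) d1 => x x1; lra.
  rewrite -/(q d); move: H5; move: (4 * d.+1%:R * ga * q d) => x; lra.
move=> s f sd; pose g i := if i \in nb E s then f i else 0.
have -> : \sum_(u in nb E s) \sum_(v in nb E s | v != u) ((adj E u v)%:R - p) * f u * f v =
    \sum_i \sum_k cmx p E s i k * g i * g k.
  rewrite big_mkcond /=; apply: eq_bigr => u _; rewrite /cmx /g.
  case: (u \in nb E s); last by rewrite big1 // => k _; rewrite mulr0 mul0r.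
  rewrite big_mkcond /=; apply: eq_bigr => v _; rewrite /adj eq_sym.
  by case: (v \in nb E s) => /=; rewrite ?mulr0 //; case: (u != v); rewrite /= ?mul0r.
have -> : \sum_(u in nb E s) f u ^+ 2 = \sum_i g i ^+ 2.
  by rewrite big_mkcond; apply: eq_bigr => u _; rewrite /g; case: ifP; rewrite ?expr0n.
apply: le_trans (Hform g sd) _; rewrite -/(q _).
apply: ler_wpM2r; first by apply: sumr_ge0 => i _; apply: sqr_ge0.
rewrite ler_wpM2r //.
rewrite -[X in X <= _]mul1r ler_wpM2r ?(ltW ga0) //; move: (d.+1%:R : R) d1 => x x1; lra.
Qed.
End Good.

(** * Markov's inequality and the union bound *)

Section Bad.
Variables (R : realType) (n : nat) (p ga : R) (d j : nat).
Implicit Types (s : {set 'I_n}) (E : {set {set 'I_n}}).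
Hypotheses (p0 : 0 < p) (ga0 : 0 < ga).
(** A power of two, so that [2 * r] is an exponent to which [form_le_walks] applies. *)
Let r := (2 ^ j)%N.
Let Q (s : {set 'I_n}) : R := n%:R * p ^+ minn #|s|.+1 d.
Let q : R := n%:R * p ^+ d.
Hypotheses (p1 : p <= 1) (q1 : 1 <= q).

Definition walk_sum (E : {set {set 'I_n}}) s : R :=
  \sum_(x : (2 * r).+1.-tuple 'I_n) walk_weight (cmx p E s) x.

(* By Markov's inequality, [Ex badness] bounds the probability that one of the
   conditions in [badness_good] fails. *)
Definition badness (E : {set {set 'I_n}}) : R :=
  \sum_(s : {set 'I_n} | (#|s| <= d)%N) \sum_(v | v \notin s)
     ((ga * Q s) ^+ (2 * r))^-1 * star p E s v ^+ (2 * r) +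
  \sum_(s : {set 'I_n} | (#|s| < d)%N) ((ga * Q s) ^+ (2 * r))^-1 * walk_sum E s.

Let r2 : (2 * r = 2 ^ j.+1)%N. Proof. by rewrite expnS. Qed.

Let Q1 s : q <= Q s.
Proof.
by rewrite ler_wpM2l ?ler0n // ler_wiXn2l ?(ltW p0) // geq_minr.
Qed.
Let Q0 s : 0 < ga * Q s.
Proof. by rewrite mulr_gt0 // (lt_le_trans _ (Q1 s)) // (lt_le_trans _ q1). Qed.

Lemma cmx_sym E s i k : cmx p E s i k = cmx p E s k i.
Proof. by rewrite /cmx eq_sym setUC; case: (i \in _); case: (k \in _). Qed.

Let walk_sum_ge0 E s : 0 <= walk_sum E s.
Proof.
rewrite /walk_sum r2.
by have [] := form_le_walks j (fun=> 0) (cmx_sym E s).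
Qed.

Let even_pow (x : R) : 0 <= x ^+ (2 * r). Proof. by rewrite exprM exprn_ge0 ?sqr_ge0. Qed.

Lemma badness_ge0 E : 0 <= badness E.
Proof.
apply: addr_ge0; apply: sumr_ge0 => s _; last by rewrite mulr_ge0 ?invr_ge0 ?even_pow.
by apply: sumr_ge0 => v _; rewrite mulr_ge0 ?invr_ge0 ?even_pow.
Qed.

Let r0 : (0 < 2 * r)%N. Proof. by rewrite r2 expn_gt0. Qed.

(** All terms are nonnegative, the walk sums being traces of even powers, so each is below 1;
    extracting [2 * r]-th roots gives the bounds. *)
Lemma badness_good E : badness E < 1 ->
  (forall (s : {set 'I_n}) v, (#|s| <= d)%N -> v \notin s ->
     `|star p E s v| <= ga * (n%:R * p ^+ minn #|s|.+1 d)) /\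
  (forall (s : {set 'I_n}) (f : 'I_n -> R), (#|s| < d)%N ->
     `|\sum_i \sum_k cmx p E s i k * f i * f k| <=
     ga * (n%:R * p ^+ #|s|.+1) * \sum_i f i ^+ 2).
Proof.
have nonneg1 s v : 0 <= ((ga * Q s) ^+ (2 * r))^-1 * star p E s v ^+ (2 * r).
  by rewrite mulr_ge0 ?invr_ge0 ?even_pow.
have nonneg2 s : 0 <= ((ga * Q s) ^+ (2 * r))^-1 * walk_sum E s.
  by rewrite mulr_ge0 ?invr_ge0 ?even_pow.
have S1 : 0 <= \sum_(s : {set 'I_n} | (#|s| <= d)%N) \sum_(v | v \notin s)
     ((ga * Q s) ^+ (2 * r))^-1 * star p E s v ^+ (2 * r).
  by apply: sumr_ge0 => s _; apply: sumr_ge0.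
have S2 : 0 <= \sum_(s : {set 'I_n} | (#|s| < d)%N) ((ga * Q s) ^+ (2 * r))^-1 * walk_sum E s.
  by apply: sumr_ge0.
rewrite /badness => bd; split.
  move=> s v sd vs.
  have : ((ga * Q s) ^+ (2 * r))^-1 * star p E s v ^+ (2 * r) <= 1.
    apply: ltW; apply: le_lt_trans bd; apply: ler_wpDr => //.
    rewrite (bigD1 s) //= (bigD1 v) //= -addrA; apply: ler_wpDr => //.
    by rewrite addr_ge0 ?sumr_ge0 // => t _; apply: sumr_ge0.
  rewrite ler_pdivrMl ?exprn_gt0 // mulr1 => H.
  rewrite -(ler_pXn2r r0) ?nnegrE ?(ltW (Q0 s)) //.
  by rewrite -normrX ger0_norm.
move=> s f sd.
have : ((ga * Q s) ^+ (2 * r))^-1 * walk_sum E s <= 1.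
  apply: ltW; apply: le_lt_trans bd; apply: ler_wpDl => //.
  by rewrite (bigD1 s) //=; apply: ler_wpDr => //; apply: sumr_ge0.
rewrite ler_pdivrMl ?exprn_gt0 // mulr1 => H.
have QE : Q s = n%:R * p ^+ #|s|.+1 by rewrite /Q (minn_idPl sd).
have ff0 : 0 <= \sum_i f i ^+ 2 by apply: sumr_ge0 => i _; apply: sqr_ge0.
have b0 : 0 <= ga * Q s * \sum_i f i ^+ 2 by rewrite mulr_ge0 // ltW.
rewrite -QE -(ler_pXn2r r0) ?nnegrE //.
rewrite -normrX ger0_norm // exprMn.
have [_ H2] := form_le_walks j f (cmx_sym E s).
rewrite -r2 in H2; apply: le_trans H2 _.
by rewrite ler_wpM2r ?exprn_ge0.
Qed.

Lemma card_small_sets m : (0 < n)%N ->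
  #|[set s : {set 'I_n} | (#|s| <= m)%N]|%:R <= m.+1%:R * n%:R ^+ m :> R.
Proof.
move=> n0; rewrite -natrX -natrM ler_nat -sum1_card.
rewrite (partition_big (fun s : {set 'I_n} => inord #|s| : 'I_m.+1) xpredT) //=.
apply: leq_trans (_ : \sum_(i < m.+1) n ^ m <= _)%N; last first.
  by rewrite sum_nat_const card_ord.
apply: leq_sum => i _; rewrite sum1_card.
apply: leq_trans (_ : #|[set s : {set 'I_n} | #|s| == i]| <= _)%N.
  apply/subset_leq_card/subsetP => s; rewrite !inE -topredE /= inE => /andP[sm /eqP <-].
  by rewrite inordK.
rewrite card_draws card_ord; apply: leq_trans (bin_le_exp _ _) _.
by rewrite leq_pexp2l // -ltnS.
Qed.

(** There are at most [d.+1 * n ^ d] sets [s]. The remaining factor [n] counts the vertices [v] in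
    the first sum and comes from [walk_moment] in the second. Dividing a moment of order [Q ^+ r] by
    [Q ^+ (2 * r)] leaves at most [q ^- r]. *)
Lemma Ex_badness : (0 < n)%N ->
  Ex p badness <= d.+1%:R * n%:R ^+ d.+1 *
    ((ga ^+ (2 * r))^-1 * (moment_cst R (2 * r) + moment_cst R (2 * r).+1)) * (q ^+ r)^-1.
Proof.
move=> n0.
have rr0 : (0 < r)%N by rewrite expn_gt0.
have cst0 l : 0 <= moment_cst R l by rewrite mulr_ge0 ?exprn_ge0.
set K := (ga ^+ (2 * r))^-1; set qr := (q ^+ r)^-1.
have q0 : 0 < q by apply: lt_le_trans q1.
have qr0 : 0 <= qr by rewrite invr_ge0 exprn_ge0 // ltW.
have K0 : 0 <= K by rewrite invr_ge0 exprn_ge0 // ltW.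
have QQ s : ((ga * Q s) ^+ (2 * r))^-1 * Q s ^+ r <= K * qr.
  have Qs0 : 0 < Q s by apply: lt_le_trans q0 (Q1 s).
  rewrite exprMn invfM -mulrA ler_wpM2l //.
  have -> : (Q s ^+ (2 * r))^-1 * Q s ^+ r = (Q s ^+ r)^-1.
    rewrite mul2n -addnn exprD invfM -mulrA mulVf ?mulr1 // expf_neq0 // gt_eqF //.
  by rewrite lef_pV2 ?posrE ?exprn_gt0 // lerXn2r ?nnegrE ?(ltW q0) ?(ltW Qs0).
have Qle s : n%:R * p ^+ #|s|.+1 <= Q s.
  by rewrite ler_wpM2l ?ler0n // ler_wiXn2l ?(ltW p0) // geq_minl.
have inv0 s : 0 <= ((ga * Q s) ^+ (2 * r))^-1 by rewrite invr_ge0 exprn_ge0 // ltW.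
have star_le s v : v \notin s ->
    Ex p (fun E => ((ga * Q s) ^+ (2 * r))^-1 * star p E s v ^+ (2 * r)) <=
    moment_cst R (2 * r) * (K * qr).
  move=> vs; rewrite ExZ.
  have H := star_moment (ltW p0) p1 r vs (le_trans q1 (Q1 s)) (Qle s).
  apply: le_trans (ler_wpM2l (inv0 s) H) _; rewrite mulrCA ler_wpM2l //.
have walk_le s : Ex p (fun E => ((ga * Q s) ^+ (2 * r))^-1 * walk_sum E s) <=
    moment_cst R (2 * r).+1 * (n%:R * (K * qr)).
  rewrite ExZ.
  have H := walk_moment (ltW p0) p1 rr0 (le_trans q1 (Q1 s)) (Qle s).
  apply: le_trans (ler_wpM2l (inv0 s) H) _; rewrite mulrCA ler_wpM2l //.
  by rewrite mulrCA ler_wpM2l.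
have cK1 : 0 <= moment_cst R (2 * r) * (K * qr) by rewrite !mulr_ge0.
have cK2 : 0 <= moment_cst R (2 * r).+1 * (n%:R * (K * qr)).
  by apply: (mulr_ge0 (cst0 _)); apply: mulr_ge0 => //; apply: mulr_ge0.
rewrite /badness ExD Ex_sum.
have T1 : \sum_(s : {set 'I_n} | (#|s| <= d)%N) Ex p (fun E => \sum_(v | v \notin s)
      ((ga * Q s) ^+ (2 * r))^-1 * star p E s v ^+ (2 * r)) <=
    (d.+1%:R * n%:R ^+ d) * (n%:R * (moment_cst R (2 * r) * (K * qr))).
  apply: le_trans (_ : \sum_(s : {set 'I_n} | (#|s| <= d)%N) n%:R * (moment_cst R (2 * r) * (K * qr)) <= _).
    apply: ler_sum => s _; rewrite Ex_sum.
    apply: le_trans (_ : \sum_(v : 'I_n) moment_cst R (2 * r) * (K * qr) <= _).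
      by rewrite big_mkcond; apply: ler_sum => v _; case: ifP => // vs; apply: star_le.
    by rewrite sumr_const card_ord -[X in X <= _]mulr_natl.
  rewrite (eq_bigl (fun s => s \in [set s : {set 'I_n} | (#|s| <= d)%N])); last by move=> s; rewrite inE.
  rewrite sumr_const -[X in X <= _]mulr_natl ler_wpM2r ?mulr_ge0 //.
  exact: card_small_sets.
have T2 : Ex p (fun E => \sum_(s : {set 'I_n} | (#|s| < d)%N) ((ga * Q s) ^+ (2 * r))^-1 * walk_sum E s) <=
    (d.+1%:R * n%:R ^+ d) * (moment_cst R (2 * r).+1 * (n%:R * (K * qr))).
  rewrite Ex_sum.
  apply: le_trans (_ : \sum_(s : {set 'I_n} | (#|s| <= d)%N) moment_cst R (2 * r).+1 * (n%:R * (K * qr)) <= _).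
    rewrite big_mkcond [X in _ <= X]big_mkcond; apply: ler_sum => s _ /=.
    by case: ifP => [sd|_]; [rewrite (ltnW sd)|case: ifP].
  rewrite (eq_bigl (fun s => s \in [set s : {set 'I_n} | (#|s| <= d)%N])); last by move=> s; rewrite inE.
  rewrite sumr_const -[X in X <= _]mulr_natl ler_wpM2r //.
  exact: card_small_sets.
apply: le_trans (lerD T1 T2) _; rewrite le_eqVlt; apply/orP; left; apply/eqP.
rewrite exprS; move: (moment_cst R (2 * r)) (moment_cst R (2 * r).+1) => m1 m2; ring.
Qed.
End Bad.

(** * Choice of the parameters and conclusion *)

Lemma powR_eventually_ge (R : realType) (x K : R) : 0 < x ->
  exists N : nat, forall n : nat, (N <= n)%N -> K <= n%:R `^ x.
Proof.
move=> x0; pose K' := Num.max K 1.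
have K'0 : 0 < K' by rewrite lt_max ltr01 orbT.
pose y := K' `^ x^-1.
exists (Num.bound y) => n Nn.
have yn : y <= n%:R.
  apply: le_trans (ler_norm _) _; apply: ltW; apply: lt_le_trans (archi_boundP (normr_ge0 _)) _.
  by rewrite ler_nat ger0_norm ?powR_ge0.
apply: le_trans (_ : K' <= _); first by rewrite le_max lexx.
have -> : K' = y `^ x by rewrite -powRrM mulVf ?gt_eqF // powRr1 // ltW.
by apply: ge0_ler_powR; rewrite ?nnegrE ?powR_ge0 ?ler0n ?(ltW x0).
Qed.

Lemma Zt_homology_vanishes (R : realType) (d k : nat) (alpha : R) :
  (0 < d)%N -> 0 < alpha -> alpha < d%:R^-1 -> ((k == 2 * d) || (k == 2 * d - 1))%N ->
  whp_overwhelming alpha (fun n E => homology_vanishes (Zt E) k).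
Proof.
move=> d0 a0 ad kd C C0.
have dR0 : 0 < d%:R :> R by rewrite ltr0n.
(* The exponent with [n p^d = n^eta]; it is positive exactly when [alpha] is below [1/d]. *)
pose eta : R := 1 - alpha * d%:R.
have eta0 : 0 < eta by rewrite subr_gt0 -ltr_pdivlMr // div1r.
(* With this value [4 * eps] is Garland's threshold [1/(k+2)]; [dl] and [ga] are then the errors
   required by [pseudorandom_garland] and [good_pseudorandom]. *)
pose eps : R := (4 * k.+2%:R)^-1.
pose dl : R := eps / (4 * (6 * d%:R + 1)).
pose ga : R := dl / (4 * d.+1%:R).
have k2 : 3 <= k.+2%:R :> R by rewrite ler_nat; clear -kd d0; lia.
have eps0 : 0 < eps by rewrite invr_gt0; move: (k.+2%:R : R) k2 => x; lra.
have eps8 : eps <= 8^-1.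
  by rewrite lef_pV2 ?posrE //; move: (k.+2%:R : R) k2 => x; lra.
have c0 : 0 < 4 * (6 * d%:R + 1) :> R by move: (d%:R : R) dR0 => x; lra.
have dl0 : 0 < dl by rewrite divr_gt0.
have d10 : 0 < 4 * d.+1%:R :> R by rewrite mulr_gt0 ?ltr0n.
have ga0 : 0 < ga by rewrite divr_gt0.
have dlE : dl = 4 * d.+1%:R * ga by rewrite /ga mulrC divfK // gt_eqF.
have dl_eps : 4 * (6 * d%:R + 1) * dl <= eps by rewrite /dl mulrC divfK // gt_eqF.
have dl1 : dl <= 1.
  rewrite ler_pdivrMr //; move: (d%:R : R) dR0 eps8 => x; lra.
have ga1 : 2 * d.+1%:R * ga <= 1.
  move: dl1; rewrite dlE; have : 0 <= d.+1%:R * ga by rewrite mulr_ge0 ?ler0n ?(ltW ga0).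
  rewrite -!mulrA; move: (d.+1%:R * ga) => x; lra.
(* The moment is taken so high that [n^(d+1) * n^(-eta r)] is at most [n^(-1-C)]; the spare factor
   [1/n] will absorb the constant [K]. *)
pose j := Num.bound ((C + d%:R + 2) / eta).
pose r := (2 ^ j)%N.
have rC : C + d%:R + 2 <= eta * r%:R.
  rewrite mulrC -ler_pdivrMr //; apply: ltW.
  apply: le_lt_trans (ler_norm _) _; rewrite ger0_norm; last by rewrite divr_ge0 ?(ltW eta0) // !addr_ge0 // ltW.
  apply: lt_le_trans (archi_boundP _) _; first by rewrite divr_ge0 ?(ltW eta0) // !addr_ge0 // ltW.
  by rewrite ler_nat ltnW // ltn_expl.
pose K : R := d.+1%:R * ((ga ^+ (2 * r))^-1 * (moment_cst R (2 * r) + moment_cst R (2 * r).+1)).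
have [N1 HN1] := powR_eventually_ge ga^-1 a0.
have [N2 HN2] := powR_eventually_ge ga^-1 eta0.
have [N3 HN3] := powR_eventually_ge K (@ltr01 R).
(* The thresholds ensure in turn [0 < n], [p <= ga], [1 <= ga * (n p^d)] and [K <= n]. *)
exists (maxn 1 (maxn N1 (maxn N2 N3))) => n; rewrite !geq_max => /and4P[n0 /HN1 h1 /HN2 h2 /HN3 h3].
have nR : 0 < n%:R :> R by rewrite ltr0n.
have n1 : 1 <= n%:R :> R by rewrite ler1n.
rewrite powRr1 ?ler0n // in h3.
set p := n%:R `^ (- alpha).
have p0 : 0 < p by rewrite powR_gt0.
have pE : p = (n%:R `^ alpha)^-1 by rewrite /p powRN.
have pga : p <= ga by rewrite pE invf_ple ?posrE ?powR_gt0.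
have ga_le1 : ga <= 1.
  apply: le_trans ga1; rewrite ler_peMl ?(ltW ga0) //.
  by rewrite -natrM ler1n.
have p1 : p <= 1 by apply: le_trans ga_le1.
have qE : n%:R * p ^+ d = n%:R `^ eta.
  rewrite -powR_mulrn ?(ltW p0) // /p -powRrM -{1}(powRr1 (ltW nR)) -powRD ?mulNr //.
  by rewrite (gt_eqF nR) implybT.
have qd : 1 <= ga * (n%:R * p ^+ d) by rewrite qE -ler_pdivrMl // mulr1.
have q1 : 1 <= n%:R * p ^+ d.
  apply: le_trans qd _; rewrite ler_piMl // mulr_ge0 ?exprn_ge0 // ltW //.
apply: le_trans (_ : Ex p (badness p ga d j) <= _).
  apply: ER_prob_le; rewrite ?(ltW p0) // => E; first exact: badness_ge0.
  move=> nH; rewrite leNgt; apply/negP => bd; apply: nH.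
  have [Hs Hf] := badness_good p0 ga0 p1 q1 bd.
  have HE := good_pseudorandom p0 pga ga1 qd Hs Hf; rewrite -dlE in HE.
  apply: (pseudorandom_garland d0 p0 _ eps8 dl_eps _ HE kd).
  - apply: le_trans pga _; rewrite dlE ler_peMl ?(ltW ga0) //.
    by rewrite -natrM ler1n.
  - apply: le_trans qd _; rewrite ler_wpM2r ?mulr_ge0 ?exprn_ge0 ?(ltW p0) ?(ltW nR) //.
    by rewrite dlE ler_peMl ?(ltW ga0) // -natrM ler1n.
  - by rewrite /eps invfM mulrA divff ?mul1r // gt_eqF.
apply: le_trans (Ex_badness j p0 ga0 p1 q1 n0) _.
rewrite qE -/r.
have -> : d.+1%:R * n%:R ^+ d.+1 *
    (ga ^- (2 * r) * (moment_cst R (2 * r) + moment_cst R (2 * r).+1)) * (n%:R `^ eta ^+ r)^-1 =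
    K * (n%:R ^+ d.+1 * (n%:R `^ eta ^+ r)^-1) by rewrite /K; ring.
have -> : n%:R ^+ d.+1 * (n%:R `^ eta ^+ r)^-1 = n%:R `^ (d.+1%:R - eta * r%:R).
  rewrite -[n%:R ^+ d.+1]powR_mulrn ?ler0n // -[(_ `^ eta) ^+ r]powR_mulrn ?powR_ge0 //.
  rewrite -powRrM -powRN -powRD //.
  by rewrite (gt_eqF nR) implybT.
apply: le_trans (_ : n%:R * n%:R `^ (-1 - C) <= _); last first.
  rewrite -{1}(powRr1 (ltW nR)) -powRD; last by rewrite (gt_eqF nR) implybT.
  by rewrite addrA subrr sub0r.
apply: le_trans (_ : K * n%:R `^ (-1 - C) <= _); last by rewrite ler_wpM2r ?powR_ge0.
have cst0 l : 0 <= moment_cst R l by rewrite mulr_ge0 ?exprn_ge0.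
have K0 : 0 <= K.
  apply: mulr_ge0 => //; apply: mulr_ge0; last exact: addr_ge0.
  by rewrite invr_ge0 exprn_ge0 // ltW.
rewrite ler_wpM2l //.
rewrite ler_powR //; move: rC; rewrite -natr1; lra.
Qed.

Theorem theorem6p1 (R : realType) (d : nat) (alpha : R) :
  (1 <= d)%N -> 0 < alpha ->
  (alpha < d%:R^-1 ->
     whp_overwhelming alpha (fun n E => homology_vanishes (Zt E) (2 * d))) /\
  (alpha < (d.+1)%:R^-1 ->
     whp_overwhelming alpha (fun n E => homology_vanishes (Zt E) (2 * d - 1))).
Proof.
move=> d0 a0; split=> ad; apply: (Zt_homology_vanishes d0 a0); rewrite ?eqxx ?orbT //.
(* Since [1/(d+1) < 1/d], the odd degree falls under the same lemma with the same [d]. *)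
by apply: lt_trans ad _; rewrite ltf_pV2 ?posrE ?ltr0n // ltr_nat.
Qed.
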